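(* Let $p$ be a prime and let $G = H_1 \times \ldots \times H_r$ be a non-trivial finite direct product of finitely generated pro-$p$ groups $H_j$ of positive rank gradient. Then $G$ has full Hausdorff spectrum $\mathrm{hspec}^{\mathcal{F}}(G) = [0,1]$ with respect to the Frattini series $\mathcal{F}$ of $G$.
   Context: Subgroups of pro-$p$ groups are understood to be closed and generation is topological. For a pro-$p$ group $H$, $d(H)$ denotes the minimal number of topological generators. The rank gradient of a finitely generated pro-$p$ group $G$ is $\mathrm{RG}(G) = \inf_{H} \frac{d(H)-1}{|G:H|}$, where $H$ runs over all open subgroups of $G$; $G$ has positive rank gradient if $\mathrm{RG}(G)>0$. A filtration (series) of a finitely generated infinite pro-$p$ group $G$ is a descending chain $\mathcal{S}\colon G_i$, $i\in\mathbb{N}_0$, of open normal subgroups of $G$ with trivial intersection. The Hausdorff dimension of a closed subgroup $H\le G$ with respect to $\mathcal{S}$ is $$\mathrm{hdim}_G^{\mathcal{S}}(H) = \liminf_{i\to\infty} \frac{\log_p |HG_i:G_i|}{\log_p |G:G_i|}$$ (this equals the Hausdorff dimension for the translation-invariant metric $d(x,y)=\inf\{|G:G_i|^{-1} \mid x^{-1}y\in G_i\}$). The Hausdorff spectrum is $\mathrm{hspec}^{\mathcal{S}}(G) = \{\mathrm{hdim}_G^{\mathcal{S}}(H) \mid H \le G \text{ a closed subgroup}\}\subseteq[0,1]$. The Frattini series $\mathcal{F}$ of $G$ is $\Phi_0(G)=G$ and $\Phi_i(G) = [\Phi_{i-1}(G),\Phi_{i-1}(G)]\,\Phi_{i-1}(G)^p$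 for $i\ge1$. *)

(* Defs.v *)
From HB Require Import structures.
From mathcomp Require Import all_boot all_order all_algebra finmap.
From mathcomp Require Import all_classical all_reals all_analysis.

Set Implicit Arguments.
Unset Strict Implicit.
Unset Printing Implicit Defensive.

Import Order.TTheory GRing.Theory Num.Theory.

Local Open Scope classical_set_scope.
Local Open Scope group_scope.

HB.mixin Record isTopologicalGroup G of Topological G & Group G := {
  mulg_continuous : continuous (fun x : G * G => x.1 * x.2);
  invg_continuous : continuous (fun x : G => x^-1)
}.

#[short(type="topGroupType")]
HB.structure Definition TopologicalGroup :=
  {G of Topological G & Group G & isTopologicalGroup G}.

Definition dirprod (I : Type) (H : I -> topGroupType) : Type := forall i, H i.

Section DirectProduct.
Variables (I : Type) (H : I -> topGroupType).
Local Notation P := (dirprod H).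

HB.instance Definition _ := Topological.copy P (prod_topology H).

Definition dirprod_mul (f g : P) : P := fun i => f i * g i.
Definition dirprod_one : P := fun i => 1.
Definition dirprod_inv (f : P) : P := fun i => (f i)^-1.

Lemma dirprod_mulgA : associative dirprod_mul.
Proof.
by move=> f g h; apply: functional_extensionality_dep => i; apply: mulgA.
Qed.
Lemma dirprod_mul1g : left_id dirprod_one dirprod_mul.
Proof.
by move=> f; apply: functional_extensionality_dep => i; apply: mul1g.
Qed.
Lemma dirprod_mulg1 : right_id dirprod_one dirprod_mul.
Proof.
by move=> f; apply: functional_extensionality_dep => i; apply: mulg1.
Qed.
Lemma dirprod_mulVg : left_inverse dirprod_one dirprod_inv dirprod_mul.
Proof.
by move=> f; apply: functional_extensionality_dep => i; apply: mulVg.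
Qed.
Lemma dirprod_mulgV : right_inverse dirprod_one dirprod_inv dirprod_mul.
Proof.
by move=> f; apply: functional_extensionality_dep => i; apply: mulgV.
Qed.

HB.instance Definition _ := isGroup.Build P
  dirprod_mulgA dirprod_mul1g dirprod_mulg1 dirprod_mulVg dirprod_mulgV.

Lemma dirprod_proj_continuous (i : I) : continuous (fun f : P => f i).
Proof. exact: (@proj_continuous {classic I} H i). Qed.

Lemma dirprod_continuous (T : topologicalType) (h : T -> P) :
  (forall i, continuous (fun x => h x i)) -> continuous h.
Proof.
move=> hc x; suff : h @ x --> (h x : prod_topology H) by [].
apply/cvg_sup => i U [V] [[W] oW <-] /= Whx WU.
by apply: (filterS WU); apply: hc; apply: open_nbhs_nbhs.
Qed.

Lemma dirprod_mulg_continuous : continuous (fun x : P * P => x.1 * x.2).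
Proof.
apply: dirprod_continuous => i x.
apply: (@cvg_comp _ _ _ (fun x : P * P => (x.1 i, x.2 i)) (fun y => y.1 * y.2)
  _ (nbhs (x.1 i, x.2 i))); last exact: (@mulg_continuous (H i) (x.1 i, x.2 i)).
apply: cvg_pair.
  by apply: (@cvg_comp _ _ _ fst (fun f : P => f i) _ (nbhs x.1));
    [exact: cvg_fst | exact: dirprod_proj_continuous].
by apply: (@cvg_comp _ _ _ snd (fun f : P => f i) _ (nbhs x.2));
  [exact: cvg_snd | exact: dirprod_proj_continuous].
Qed.

Lemma dirprod_invg_continuous : continuous (fun x : P => x^-1).
Proof.
apply: dirprod_continuous => i x.
apply: (@cvg_comp _ _ _ (fun f : P => f i) (fun y => y^-1) _ (nbhs (x i))).
  exact: dirprod_proj_continuous.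
exact: (@invg_continuous (H i) (x i)).
Qed.

HB.instance Definition _ :=
  isTopologicalGroup.Build P dirprod_mulg_continuous dirprod_invg_continuous.

End DirectProduct.

Section Subgroups.
Variable G : topGroupType.
Implicit Types (A B H K N : set G).

Definition is_subgroup H : Prop :=
  [/\ H 1, forall x y, H x -> H y -> H (x * y) & forall x, H x -> H x^-1].

Definition is_normal N : Prop :=
  is_subgroup N /\ forall x y, N x -> N (x ^ y).

Definition setmulg A B : set G := [set x * y | x in A & y in B].

(* the closed subgroup topologically generated by A *)
Definition tgen A : set G := closure (smallest is_subgroup A).

(* the number of left cosets xK with x in A, and 0 if there are infinitely many;
   this is |A : K| when A is a subgroup containing K *)
Definition sub_index A K : nat :=
  #|` fset_set [set setmulg [set x] K | x in A]|%fset.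

Definition tgen_by_n H (n : nat) : Prop :=
  exists2 s : seq G, size s = n & tgen [set` s] = H.

End Subgroups.

Definition finitely_generated (G : topGroupType) : Prop :=
  exists n, tgen_by_n [set: G] n.

(* finiteness of the index of N is part of the condition since p ^ k > 0 *)
Definition pro_p (p : nat) (G : topGroupType) : Prop :=
  [/\ compact [set: G], hausdorff_space G, totally_disconnected [set: G] &
      forall N : set G, is_normal N -> open N ->
        exists k, sub_index [set: G] N = (p ^ k)%N].

Section RankGradient.
Variables (R : realType) (G : topGroupType).

(* +oo when H is not topologically finitely generated *)
Definition gen_number (H : set G) : \bar R :=
  ereal_inf [set (n%:R)%:E | n in [set n | tgen_by_n H n]].

Definition rank_gradient : \bar R :=
  ereal_inf [set ((gen_number H - 1) * ((sub_index [set: G] H)%:R^-1)%:E)%E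
            | H in [set H : set G | is_subgroup H /\ open H]].

End RankGradient.

Section Hausdorff.
Variables (R : realType) (p : nat) (G : topGroupType).

Definition log_p (x : R) : R := (ln x / ln p%:R)%R.

(* the quotient at an index i with S i = G is 0 / 0 = 0, which does not affect
   the lower limit when G is infinite and S is a filtration *)
Definition hdim (S : nat -> set G) (H : set G) : \bar R :=
  limn_einf (fun i =>
    (log_p (sub_index (setmulg H (S i)) (S i))%:R /
     log_p (sub_index [set: G] (S i))%:R)%R%:E).

Definition hspec (S : nat -> set G) : set (\bar R) :=
  [set hdim S H | H in [set H : set G | is_subgroup H /\ closed H]].

Fixpoint frattini_series (i : nat) : set G :=
  if i is j.+1 then
    let F := frattini_series j in
    setmulg (tgen [set [~ x, y] | x in F & y in F]) (tgen [set x ^+ p | x in F])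
  else [set: G].

End Hausdorff.

Arguments hspec R p G S : clear implicits.
Arguments frattini_series p G i : clear implicits.

(* Main.v *)
(** Put |H_j : Phi_n(H_j)| = p ^ l_n and let 0 < a < 1. As Phi_n(H_j) is generated by
    d = l_{n+1} - l_n elements, positive rank gradient yields rho > 0 with
    d >= 1 + rho p ^ l_n, so the l_n grow like an exponential tower.

    For each factor there is a closed subgroup K_j with
    |K_j Phi_n : Phi_n| = p ^ floor(a l_n) for all large n. It is the intersection of
    open subgroups L_n >= Phi_n with L_{n+1} Phi_n = L_n and
    |L_n : Phi_n| = p ^ s for s = floor(a l_n), which are built recursively: in the finite
    p-group L_n / Phi_{n+1}, lifts of s generators of L_n / Phi_n generate a supplement
    of the elementary abelian group Phi_n / Phi_{n+1}, and by Schreier it meets that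
    group in a subgroup of order at most p ^ (s p ^ s). Since a < 1 this is negligible
    against l_{n+1} >= rho p ^ l_n, so a subgroup L_{n+1} / Phi_{n+1} of the prescribed
    order lies between the supplement and L_n / Phi_{n+1}.

    The l_n of the different factors may be of different magnitude, but the ratios for
    the K_j converge to the same a, hence so does the ratio of the sums, which belongs
    to the product of the K_j. *)

Require Import Defs.
From mathcomp Require Import all_boot all_order all_algebra all_fingroup all_solvable finmap.
From mathcomp Require Import all_classical all_reals all_analysis.
From mathcomp Require Import ring lra zify.

Set Implicit Arguments.
Unset Strict Implicit.
Unset Printing Implicit Defensive.

Import Order.TTheory GRing.Theory Num.Theory.
Import numFieldNormedType.Exports.

Local Open Scope classical_set_scope.
Local Open Scope group_scope.

(** * Topological groups *)

Section QuasiComponent.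
Variable T : topologicalType.

(* The quasi-component Q of x, i.e. the intersection of the clopen sets containing
   x, is connected: two disjoint closed pieces of Q are separated by open sets, and
   by compactness a single clopen set containing x lies in their union. *)
Lemma compact_totally_disconnected_zero_dimensional :
  hausdorff_space T -> compact [set: T] -> totally_disconnected [set: T] ->
  zero_dimensional T.
Proof.
move=> hT cT tdT x y xy; apply: contrapT => noU.
pose Q := [set z | forall C : set T, clopen C -> C x -> C z].
have Qx : Q x by [].
have Qy : Q y.
  by move=> C cC Cx; apply: contrapT => nCy; apply: noU; exists C.
have clQ : closed Q.
  have -> : Q = \bigcap_(C in [set C | clopen C /\ C x]) C.
    apply/seteqP; split=> z Qz C.
      by move=> [? ?]; apply: Qz.
    by move=> ? ?; apply: Qz.
  by apply: closed_bigI => C [[]].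
have split2 (B D : set T) : closed B -> closed D -> B `&` D = set0 ->
    Q `<=` B `|` D -> B x -> Q `<=` B.
  move=> cB cD BD QBD Bx.
  have nBD : set_nbhs B (~` D).
    apply/set_nbhsP; exists (~` D); split => //; first exact: closed_openC.
    by apply/disjoints_subset.
  have [V /set_nbhsP [W [oW BW WV]] clVD] := compact_normal hT cT cB nBD.
  pose K := ~` (W `|` ~` closure W).
  have clK : closed K.
    by apply: open_closedC; apply: openU => //; apply/closed_openC/closed_closure.
  have QK : Q `<=` ~` K.
    move=> z /QBD [Bz|Dz]; rewrite /K setCK; first by left; apply: BW.
    by right=> /(closureS WV) /clVD.
  have [C [clC Cx CK]] : exists C, [/\ clopen C, C x & C `<=` ~` K].
    apply: contrapT => nC.
    pose I := [set C : set T | clopen C /\ C x].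
    pose F := filter_from I (fun C => C `&` K).
    have FF : Filter F.
      apply: filter_from_filter; first by exists setT; split => //; exact: clopenT.
      move=> C1 C2 [c1 x1] [c2 x2]; exists (C1 `&` C2).
        by split=> //; exact: clopenI.
      by move=> z [[? ?] ?].
    have PF : ProperFilter F.
      apply: filter_from_proper => C [cC Cx]; apply: contrapT => CK0.
      by apply: nC; exists C; split=> // z Cz Kz; apply: CK0; exists z.
    have [|z [_ clz]] := cT F PF; first by exists setT => //; split => //; exact: clopenT.
    have Kz : K z.
      rewrite (_ : K = closure K); last by apply/closure_id.
      move: clz; rewrite clusterE; apply; exists setT; last by move=> ? [].
      by split => //; exact: clopenT.
    apply: (QK z) => // C cC Cx.
    have -> : C = closure C by apply/closure_id; case: cC.
    move: clz; rewrite clusterE; apply; exists C; first by split.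
    by move=> ? [].
  have cCW : clopen (C `&` W).
    split; first by apply: openI => //; case: clC.
    have -> : C `&` W = C `&` closure W.
      apply/seteqP; split=> z [Cz Wz]; split=> //; first exact: subset_closure.
      by have := CK _ Cz; rewrite /K setCK => -[].
    by apply: closedI; [case: clC | exact: closed_closure].
  move=> z Qz; have [_ Wz] := Qz _ cCW (conj Cx (BW _ Bx)).
  have [//|Dz] := QBD _ Qz.
  by have := clVD _ (subset_closure (WV _ Wz)).
have coQ : connected Q.
  move=> B [z Bz] [U oU BU] [C cC BC].
  have clB : closed B by rewrite BC; apply: closedI.
  have clD : closed (Q `&` ~` U) by apply: closedI => //; exact: open_closedC.
  have BD0 : B `&` (Q `&` ~` U) = set0.
    by rewrite BU; apply/seteqP; split => // t [[_ Ut] [_ nUt]].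
  have QBD : Q `<=` B `|` (Q `&` ~` U).
    by move=> t Qt; have [Ut|nUt] := pselect (U t); [left; rewrite BU | right].
  have [Bx|Dx] := QBD _ Qx.
    apply/seteqP; split; first by rewrite BU => t [].
    exact: (split2 _ _ clB clD).
  have QD : Q `<=` Q `&` ~` U.
    apply: (split2 _ _ clD clB _ _ Dx); first by rewrite setIC.
    by rewrite setUC.
  by move: Bz; rewrite BU => -[/QD [_ nU] Uz]; case: nU.
have : connected_component [set: T] x y by exists Q.
by rewrite (tdT x) //= => yx; move: xy; rewrite yx eqxx.
Qed.

End QuasiComponent.

Section TopGroup.
Variable G : topGroupType.
Implicit Types (A B H K N U : set G).

Lemma mulgl_continuous (a : G) : continuous (fun x : G => a * x).
Proof.
move=> x; apply: (@cvg_comp _ _ _ (fun x => (a, x)) (fun y : G * G => y.1 * y.2)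
  _ (nbhs (a, x))); last exact: (@mulg_continuous G (a, x)).
by apply: cvg_pair; [exact: cvg_cst | exact: cvg_id].
Qed.

Lemma mulgr_continuous (a : G) : continuous (fun x : G => x * a).
Proof.
move=> x; apply: (@cvg_comp _ _ _ (fun x => (x, a)) (fun y : G * G => y.1 * y.2)
  _ (nbhs (x, a))); last exact: (@mulg_continuous G (x, a)).
by apply: cvg_pair; [exact: cvg_id | exact: cvg_cst].
Qed.

Lemma open_mulgl (a : G) U : open U -> open [set x | U (a * x)].
Proof. by move=> oU; apply: open_comp => // x _; exact: (@mulgl_continuous a). Qed.

Lemma closed_mulgl (a : G) U : closed U -> closed [set x | U (a * x)].
Proof. by move=> cU; apply: preimage_closed => // x _; exact: (@mulgl_continuous a). Qed.

Lemma is_subgroup_smallest A : is_subgroup (smallest (@is_subgroup G) A).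
Proof.
split=> [H [[]] //|x y Ax Ay H HA|x Ax H HA].
  by case: (HA) => -[_ HM _] _; apply: HM; [apply: Ax|apply: Ay].
by case: (HA) => -[_ _ HV] _; apply: HV; apply: Ax.
Qed.

Lemma is_subgroup_closure H : is_subgroup H -> is_subgroup (closure H).
Proof.
move=> [H1 HM HV]; split; first exact: subset_closure.
- move=> x y clx cly U Uxy.
  have [[V W] /= [Vx Wy] VWU] := @mulg_continuous G (x, y) U Uxy.
  have [a [Ha Va]] := clx _ Vx; have [b [Hb Wb]] := cly _ Wy.
  by exists (a * b); split; [exact: HM | exact: (VWU (a, b))].
- move=> x clx U Ux; have [a [Ha Ua]] := clx _ (@invg_continuous G x U Ux).
  by exists a^-1; split => //; exact: HV.
Qed.

Lemma is_subgroup_tgen A : is_subgroup (tgen A).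
Proof. exact/is_subgroup_closure/is_subgroup_smallest. Qed.

Lemma sub_tgen A : A `<=` tgen A.
Proof. by apply: subset_trans (@subset_closure _ _); apply: sub_gen_smallest. Qed.

Lemma tgen_sub A H : is_subgroup H -> closed H -> A `<=` H -> tgen A `<=` H.
Proof.
move=> sH cH AH; rewrite (_ : H = closure H); last by apply/closure_id.
by apply: closureS; apply: smallest_sub.
Qed.

Lemma subgroup_mulr H x y : is_subgroup H -> H x -> H (y * x) <-> H y.
Proof.
move=> [_ HM HV] Hx; split=> [Hyx|Hy]; last exact: HM.
by rewrite -(mulgK x y); apply: HM => //; exact: HV.
Qed.

Lemma subgroup_mull H x y : is_subgroup H -> H x -> H (x * y) <-> H y.
Proof.
move=> [_ HM HV] Hx; split=> [Hyx|Hy]; last exact: HM.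
by rewrite -(mulKg x y); apply: HM => //; exact: HV.
Qed.

Lemma open_subgroup_closed H : is_subgroup H -> open H -> closed H.
Proof.
move=> sH oH; have [H1 HM HV] := sH; rewrite -[H]setCK; apply: open_closedC.
rewrite openE => x nHx; rewrite /interior nbhsE; exists [set y | H (x^-1 * y)].
  by split; [exact: open_mulgl | rewrite /= mulVg].
move=> y /= Hxy Hy; apply: nHx.
have : H (x^-1 * y * y^-1) by apply: HM => //; exact: HV.
by rewrite mulgK => /HV; rewrite invgK.
Qed.

Lemma subgroup_nbhs_open H U : is_subgroup H -> nbhs 1 U -> U `<=` H -> open H.
Proof.
move=> [H1 HM HV] nU UH; rewrite openE => x Hx.
have : nbhs x [set y | U (x^-1 * y)].
  by apply: (mulgl_continuous (a := x^-1)); rewrite mulVg.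
apply: filterS => y /UH Hxy.
by rewrite -(mulKVg x y); apply: HM.
Qed.

Lemma subgroup_open_sub H K : is_subgroup H -> is_subgroup K -> open K ->
  K `<=` H -> open H.
Proof.
move=> sH sK oK; apply: subgroup_nbhs_open => //.
by apply: open_nbhs_nbhs; split => //; case: sK.
Qed.

End TopGroup.

(** * Open normal subgroups and finite quotients *)

Section OpenNormalBasis.
Variable G : topGroupType.
Implicit Types (A B H K N U : set G).

Lemma conjg_continuous : continuous (fun z : G * G => z.1 ^ z.2).
Proof.
move=> z; rewrite /conjg.
apply: (@cvg_comp _ _ _ (fun z : G * G => (z.2^-1, z.1 * z.2))
  (fun y : G * G => y.1 * y.2) _ (nbhs (z.2^-1, z.1 * z.2)));
  last exact: (@mulg_continuous G (z.2^-1, z.1 * z.2)).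
apply: cvg_pair; last exact: mulg_continuous.
apply: (@cvg_comp _ _ _ snd (fun x => x^-1) _ (nbhs z.2)); first exact: cvg_snd.
exact: invg_continuous.
Qed.

(* W = {x | C x <= C} for a clopen C is a neighbourhood of 1 by compactness of C;
   then V = W cap W^-1 is an open subgroup, and its core N is open by compactness
   of G. *)
Lemma open_normal_basis U : compact [set: G] -> hausdorff_space G ->
  totally_disconnected [set: G] -> nbhs 1 U ->
  exists N, [/\ is_normal N, open N & N `<=` U].
Proof.
move=> cG hG tG nU.
have zG := compact_totally_disconnected_zero_dimensional hG cG tG.
have [C [C1 [oC cC]] CU] := zero_dimensional_cvg (x := 1) hG zG cG nU.
pose W := [set x | forall c, C c -> C (c * x)].
have nW : nbhs 1 W.
  have /compact_near_coveringP/(_ G (nbhs 1) (fun i c => C (c * i))) :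
    compact C by exact: subclosed_compact cC cG _.
  apply=> c Cc; have nC : nbhs (c * 1) C by apply: open_nbhs_nbhs; rewrite mulg1.
  have [[A B] /= [Ac B1] ABC] := @mulg_continuous G (c, 1) C nC.
  by exists (A, B).
have W1 : W 1 by move=> c; rewrite mulg1.
have WM x y : W x -> W y -> W (x * y) by move=> Wx Wy c Cc; rewrite mulgA; auto.
pose V := [set x | W x /\ W x^-1].
have sV : is_subgroup V.
  split; first by split; rewrite ?invg1.
    by move=> x y [Wx Wx'] [Wy Wy']; split; rewrite ?invgM; apply: WM.
  by move=> x [Wx Wx']; split; rewrite ?invgK.
have nV : nbhs 1 V.
  apply: filterI => //; apply: (@invg_continuous G 1).
  by rewrite invg1.
have VU : V `<=` U by move=> x [Wx _]; apply: CU; rewrite -(mul1g x); apply: Wx.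
pose N := [set x | forall g, V (x ^ g)].
have nN : nbhs 1 N.
  have /compact_near_coveringP/(_ G (nbhs 1) (fun i g => V (i ^ g))) H := cG.
  suff : nbhs 1 (fun i => [set: G] `<=` (fun g => V (i ^ g))).
    by apply: filterS => x Hx g; exact: Hx.
  apply: H => g _.
  have nVg : nbhs ((1 : G, g).1 ^ (1 : G, g).2) V by rewrite /= conj1g.
  have [[A B] /= [A1 Bg] ABV] := @conjg_continuous (1, g) V nVg.
  by exists (B, A) => // -[b a] [/= Bb Aa]; apply: (ABV (a, b)).
have sN : is_subgroup N.
  case: sV => V1 VM VV; split.
  - by move=> g; rewrite conj1g.
  - by move=> x y Nx Ny g; rewrite conjMg; apply: VM.
  - by move=> x Nx g; rewrite conjVg; apply: VV.
exists N; split; last by move=> x /(_ 1); rewrite conjg1; exact: VU.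
  by split => // x y Nx g; rewrite -conjgM; exact: Nx.
exact: subgroup_nbhs_open nN _.
Qed.

Lemma setmulg1P N x y : setmulg [set x] N y <-> N (x^-1 * y).
Proof.
split=> [[_ -> [n Nn <-]]|Nxy]; first by rewrite mulKg.
by exists x => //; exists (x^-1 * y) => //; rewrite mulKVg.
Qed.

Lemma setmulg_absorb A N : is_subgroup A -> is_subgroup N ->
  N `<=` A -> setmulg A N = A.
Proof.
move=> [A1 AM AV] [N1 _ _] NA; apply/seteqP; split.
  by move=> _ [x Ax [y Ny <-]]; apply: AM => //; apply: NA.
by move=> x Ax; exists x => //; exists 1; rewrite ?mulg1.
Qed.

Lemma eq_coset N x y : is_subgroup N ->
  setmulg [set x] N = setmulg [set y] N <-> N (x^-1 * y).
Proof.
move=> sN; split=> [xy|Nxy].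
  by apply/setmulg1P; rewrite xy; apply/setmulg1P; rewrite mulVg; case: sN.
have Nyx : N (y^-1 * x) by case: sN => _ _ /(_ _ Nxy); rewrite invgM invgK.
apply/seteqP; split=> z /setmulg1P Nz; apply/setmulg1P.
  by rewrite -(mulKVg x z) mulgA; apply/(subgroup_mull _ sN).
by rewrite -(mulKVg y z) mulgA; apply/(subgroup_mull _ sN).
Qed.

Lemma finite_cosets N : compact [set: G] -> is_subgroup N -> open N ->
  finite_set [set setmulg [set x] N | x in [set: G]].
Proof.
move=> cG sN oN.
(* Compactness in near-covering form, for the filter of finite lists ordered by inclusion: near [x]
   every list containing [x] works, so a single finite list meets all cosets. *)
pose F : set_system (seq G) :=
  filter_from [set: seq G] (fun s0 => [set s : seq G | {subset s0 <= s}]).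
have FF : Filter F.
  apply: filter_from_filter; first by exists [::].
  move=> s t _ _; exists (s ++ t) => // u stu; split=> z zs; apply: stu;
    by rewrite mem_cat zs ?orbT.
have /compact_near_coveringP/(_ _ F
  (fun s x => exists2 y, y \in s & N (y^-1 * x))) H := cG.
have [s _ /(_ s (fun x xs => xs)) Hs] : F (fun s => [set: G] `<=`
  (fun x => exists2 y, y \in s & N (y^-1 * x))).
  apply: H => x _; exists ([set y | N (x^-1 * y)], [set s : seq G | x \in s]).
    split=> /=; last by exists [:: x] => // s; apply; rewrite mem_head.
    by apply: open_nbhs_nbhs; split; [exact: open_mulgl | rewrite /= mulVg; case: sN].
  by move=> [y s] /= [Ny xs]; exists x.
apply: (sub_finite_set (B := [set setmulg [set x] N | x in [set` s]])).
  move=> _ [x _ <-]; have [y ys Nyx] := Hs x I.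
  by exists y => //; apply/eq_coset.
exact: finite_image.
Qed.

End OpenNormalBasis.

(** Membership is decided classically, which turns images of arbitrary subsets into finite sets open
    to finite group theory. *)
Definition fim (G : Type) (T : finType) (f : G -> T) (A : set G) : {set T} :=
  finset (fun t => `[< (f @` A) t >]).

Lemma fimP (G : Type) (T : finType) (f : G -> T) (A : set G) t :
  reflect (exists2 x, A x & f x = t) (t \in fim f A).
Proof. by rewrite inE; exact: asboolP. Qed.

Lemma mem_fim (G : Type) (T : finType) (f : G -> T) (A : set G) x :
  A x -> f x \in fim f A.
Proof. by move=> Ax; apply/fimP; exists x. Qed.

Lemma fimS (G : Type) (T : finType) (f : G -> T) (A B : set G) :
  A `<=` B -> fim f A \subset fim f B.
Proof. by move=> AB; apply/fintype.subsetP => _ /fimP [x Ax <-]; apply/mem_fim/AB. Qed.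

(** The cosets of [N] are the fibres of [f], so those meeting [A] are counted by the values of [f]
    on [A]. The target is only a finite type: it is later also a set of cosets or a finite
    product. *)
Lemma sub_indexE (G : topGroupType) (T : finType) (f : G -> T) (N A : set G) :
  is_subgroup N -> (forall x y, f x = f y <-> N (x^-1 * y)) ->
  sub_index A N = #|fim f A|.
Proof.
move=> sN fE; rewrite /sub_index; apply: card_fset_set.
have -> : [set setmulg [set x] N | x in A] =
    [set (f @^-1` [set t]) | t in [set` fim f A]].
  have cE x : setmulg [set x] N = f @^-1` [set f x].
    apply/seteqP; split=> y.
      by move=> /setmulg1P /fE ->.
    by move=> /esym /fE Nxy; apply/setmulg1P.
  apply/seteqP; split=> [_ [x Ax <-]|_ [_ /fimP [x Ax <-] <-]].
    by exists (f x); [exact: mem_fim | rewrite cE].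
  by exists x => //; rewrite cE.
apply: (@card_eq_trans _ _ _ _ [set` fim f A]).
  apply: inj_card_eq => s t; rewrite !inE => /fimP [x Ax <-] /fimP [y Ay <-] xy.
  have : (f @^-1` [set f x]) x by [].
  by rewrite xy => <-.
rewrite (_ : [set` fim f A] = [set` [fset t in fim f A]%fset]); last first.
  by apply/seteqP; split=> t /=; rewrite !inE.
apply/card_eq_fsetP; rewrite cardE; apply: perm_size; apply: uniq_perm.
- exact: fset_uniq.
- exact: enum_uniq.
- by move=> t; rewrite mem_enum; rewrite inE /=.
Qed.

(** Surjectivity is not asked for: [gT] may be larger than G/N, for instance a full group of
    permutations, and the quotient itself is [fim f [set: G]]. *)
Record is_quotient (G : topGroupType) (N : set G) (gT : finGroupType)
    (f : G -> gT) : Prop := IsQuotient {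
  quot_mul : {morph f : x y / x * y};
  quot_ker : forall x, f x = 1 <-> N x }.

Section FiniteQuotient.
Variable G : topGroupType.
Implicit Types (A B H K N U : set G).

(* The quotient is realised as permutations of the cosets of N: right translation
   by g sends C to C g, because N is normal. *)
Lemma finite_quotient N : compact [set: G] -> is_normal N -> open N ->
  exists (gT : finGroupType) (f : G -> gT), is_quotient N f.
Proof.
move=> cG [sN nN] oN; have fN := finite_cosets cG sN oN.
pose X := fset_set [set setmulg [set x] N | x in [set: G]].
have XP (x : G) : setmulg [set x] N \in X by rewrite in_fset_set // inE; exists x.
have act_in (g : G) (C : X) : [set y | val C (y * g^-1)] \in X.
  have := valP C; rewrite in_fset_set // inE => -[x _ Cx].
  rewrite in_fset_set // inE; exists (x * g) => //; rewrite -Cx.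
  apply/seteqP; split=> y /= /setmulg1P Ny; apply/setmulg1P.
    have := nN _ g^-1 Ny; rewrite conjgE invgK invgM.
    by rewrite !mulgA mulgV mul1g.
  have := nN _ g Ny; rewrite conjgE invgM.
  by rewrite !mulgA mulgKV.
pose act g C : X := [` act_in g C]%fset.
have actM g h C : act h (act g C) = act (g * h) C.
  by apply/val_inj/seteqP; split=> y /=; rewrite invgM mulgA.
have act1 C : act 1 C = C.
  by apply/val_inj/seteqP; split=> y /=; rewrite invg1 mulg1.
have act_inj g : injective (act g).
  by apply: (can_inj (g := act g^-1)) => C; rewrite actM mulgV act1.
exists {perm X}, (fun g => perm (@act_inj g)); split.
  by move=> g h; apply/permP => C; rewrite permM !permE actM.
move=> g; split.
  move=> /permP /(_ [` XP 1]%fset); rewrite permE perm1 => /(congr1 val) /= E.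
  have : setmulg [set 1] N 1 by apply/setmulg1P; rewrite mulVg; case: sN.
  rewrite -E /= mul1g => /setmulg1P; rewrite invg1 mul1g.
  by case: sN => _ _ HV /HV; rewrite invgK.
move=> Ng; apply/permP => C; rewrite permE perm1; apply/val_inj => /=.
have := valP C; rewrite in_fset_set // inE => -[x _ <-].
have Ng' : N g^-1 by case: sN => _ _; apply.
apply/seteqP; split=> y /= /setmulg1P Ny; apply/setmulg1P.
  by move: Ny; rewrite mulgA => /(subgroup_mulr _ sN Ng').
by rewrite mulgA; apply/(subgroup_mulr _ sN Ng').
Qed.

Section Quotient.
Variables (N : set G) (gT : finGroupType) (f : G -> gT).
Hypotheses (sN : is_subgroup N) (fq : is_quotient N f).

Lemma quot1 : f 1 = 1.
Proof. by apply/(quot_ker fq); case: sN. Qed.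

Lemma quot_inv : {morph f : x / x^-1}.
Proof.
by move=> x; apply: (mulgI (f x)); rewrite -(quot_mul fq) !mulgV quot1.
Qed.

Lemma quot_eq x y : f x = f y <-> N (x^-1 * y).
Proof.
rewrite -(quot_ker fq) (quot_mul fq) quot_inv; split=> [->|E]; first by rewrite mulVg.
by apply: (mulgI (f x)^-1); rewrite E mulVg.
Qed.

Lemma quot_conj : {morph f : x y / x ^ y}.
Proof. by move=> x y; rewrite !conjgE !(quot_mul fq) quot_inv. Qed.

Lemma quot_exp n : {morph f : x / x ^+ n}.
Proof.
by move=> x; elim: n => [|n IH]; rewrite ?expg0 ?quot1 // !expgS (quot_mul fq) IH.
Qed.

Lemma quot_comm : {morph f : x y / [~ x, y]}.
Proof. by move=> x y; rewrite !commgEl (quot_mul fq) quot_inv quot_conj. Qed.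

Lemma group_set_fim A : is_subgroup A -> group_set (fim f A).
Proof.
move=> [A1 AM AV]; apply/group_setP; split; first by rewrite -quot1; apply: mem_fim.
by move=> _ _ /fimP [x Ax <-] /fimP [y Ay <-]; rewrite -(quot_mul fq); apply/mem_fim/AM.
Qed.

Lemma sub_index_quot A : sub_index A N = #|fim f A|.
Proof. by apply: sub_indexE => // x y; exact: quot_eq. Qed.

Lemma preim_quot_subgroup (M : {group gT}) : is_subgroup [set x | f x \in M].
Proof.
split=> /=; first by rewrite quot1 group1.
  by move=> x y Mx My; rewrite (quot_mul fq) groupM.
by move=> x Mx; rewrite quot_inv groupV.
Qed.

Lemma open_preim_quot (M : {group gT}) : open N -> open [set x | f x \in M].
Proof.
move=> oN; apply: subgroup_open_sub oN _ => //; first exact: preim_quot_subgroup.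
by move=> x /(quot_ker fq) /= ->; rewrite group1.
Qed.

Lemma fim_preim (M : {set gT}) : M \subset fim f [set: G] ->
  fim f [set x | f x \in M] = M.
Proof.
move=> MG; apply/setP => t; apply/fimP/idP => [[x Mx <-] //|Mt].
by have /fimP [x _ ft] := fintype.subsetP MG _ Mt; exists x; rewrite //= ft.
Qed.

Lemma fim_setmulg A B : fim f (setmulg A B) = fim f A * fim f B.
Proof.
apply/setP => t; apply/fimP/mulsgP.
  move=> [_ [x Ax [y By <-]] <-]; rewrite (quot_mul fq).
  by exists (f x) (f y) => //; apply: mem_fim.
move=> [_ _ /fimP [x Ax <-] /fimP [y By <-] ->]; rewrite -(quot_mul fq).
by exists (x * y) => //; exists x => //; exists y.
Qed.

(** The preimage of [<<fim f A>>] is a subgroup containing the open subgroup [N], hence open and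
    closed. Topological generation thus becomes ordinary generation in the quotient. *)
Lemma fim_tgen A : open N -> fim f (tgen A) = <<fim f A>>.
Proof.
move=> oN; apply/eqP; rewrite finset.eqEsubset; apply/andP; split; last first.
  rewrite (gen_subG _ (group (group_set_fim (is_subgroup_tgen A)))).
  by apply: fimS; apply: sub_tgen.
apply/fintype.subsetP => _ /fimP [x Ax <-].
apply: (tgen_sub (H := [set x | f x \in <<fim f A>>])) Ax.
- exact: preim_quot_subgroup.
- by apply: open_subgroup_closed; [exact: preim_quot_subgroup | exact: open_preim_quot].
- by move=> y Ay; apply: mem_gen; apply: mem_fim.
Qed.

End Quotient.
End FiniteQuotient.

(** * Supplements in finite p-groups *)

Section FiniteGroups.
Variable gT : finGroupType.
Implicit Types (D E L M : {group gT}) (S Y : {set gT}).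

(** Schreier's lemma: [Y] consists of the elements r s r'^-1, where r runs over right coset
    representatives, s over [S], and r' represents the coset of r s. *)
Lemma finite_schreier D M S : normal D M -> M :=: <<S>> ->
  exists2 Y : {set gT}, (#|Y| <= #|M : D| * #|S|)%N & D :=: <<Y>>.
Proof.
move=> /andP [sDM nDM] MS.
have SM : S \subset M by rewrite MS subset_gen.
pose y (C : {set gT}) (s : gT) := repr C * s * (repr (C :* s))^-1.
exists (y @2: (rcosets D M, S)).
  by rewrite curry_imset2X (leq_trans (leq_imset_card _ _)) // cardsX.
set Y := y @2: (_, _).
have sYD : Y \subset D.
  apply/fintype.subsetP => _ /imset2P [_ s /rcosetsP [x Mx ->] Ss ->].
  rewrite /y -rcosetM; case: repr_rcosetP => d1 Dd1; case: repr_rcosetP => d2 Dd2.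
  by rewrite invMg mulgA -(mulgA d1) mulgK groupM ?groupV.
apply/eqP; rewrite finset.eqEsubset gen_subG sYD andbT.
(* [Z] is closed under products because [y C (z * w) = y C z * y (C :* z) w], so it contains [M].
   For z in [D] the coset [C = D], represented by 1, then gives [y D z = z]. *)
pose Z : {set gT} :=
  finset (fun z : gT => (z \in M) && [forall C in rcosets D M, y C z \in <<Y>>]).
have gZ : group_set Z.
  apply/group_setP; split.
    rewrite inE group1; apply/forall_inP => C _.
    by rewrite /y rcoset1 mulg1 mulgV group1.
  move=> z w; rewrite !inE => /andP [Mz /forall_inP Zz] /andP [Mw /forall_inP Zw].
  rewrite groupM //; apply/forall_inP => C DC.
  have -> : y C (z * w) = y C z * y (C :* z) w.
    by rewrite /y rcosetM !mulgA mulgKV.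
  rewrite groupM ?Zz // Zw //; have /rcosetsP [x Mx ->] := DC.
  by apply/rcosetsP; exists (x * z); rewrite ?groupM // rcosetM.
have SZ : S \subset Z.
  apply/fintype.subsetP => s Ss; rewrite inE (fintype.subsetP SM) //.
  by apply/forall_inP => C DC; apply: mem_gen; apply/imset2P; exists C s.
have MZ : M \subset Group gZ by rewrite MS gen_subG.
apply/fintype.subsetP => z Dz.
have /(fintype.subsetP MZ) : z \in M by apply: (fintype.subsetP sDM).
rewrite inE => /andP [_ /forall_inP /(_ D)].
rewrite /y rcoset_id // repr_group mul1g invg1 mulg1.
by apply; apply/rcosetsP; exists 1; rewrite ?group1 // rcoset1.
Qed.

(** Induction on [s] through a maximal subgroup above [E], which has index p: one element outside
    it, added to its generators over [E], generates [L] over [E]. *)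
Lemma pgroup_gen_over p (E L : {group gT}) s : prime p -> p.-group L -> E \subset L ->
  #|L : E| = (p ^ s)%N ->
  exists S : {set gT}, [/\ S \subset L, (#|S| <= s)%N & S <*> E = L].
Proof.
move=> pp; elim: s L => [|s IH] L pL sEL iLE.
  exists finset.set0; rewrite finset.sub0set cards0; split=> //.
  rewrite /joing finset.set0U genGid; apply/eqP; rewrite finset.eqEsubset sEL /=.
  by rewrite -indexg_eq1 iLE expn0.
have [EL|[M mM sEM]] := maximal_exists sEL.
  move: iLE; rewrite EL indexgg => /eqP.
  by rewrite eq_sym -(expn0 p) eqn_exp2l ?prime_gt1.
have [/properP [sML [x Lx Mx]] maxM] := maxgroupP mM.
have iLM := p_maximal_index pL mM.
have [] := IH M (pgroupS sML pL) sEM.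
  apply/eqP; rewrite -(eqn_pmul2l (prime_gt0 pp)) -expnS -iLE.
  by rewrite -(Lagrange_index sML sEM) iLM.
move=> S [SM cS SE]; exists (x |: S); split.
- by rewrite finset.subUset finset.sub1set Lx (fintype.subset_trans SM).
- by rewrite cardsU1 -add1n leq_add // leq_b1.
- have sK : (x |: S) <*> E \subset L.
    by rewrite join_subG finset.subUset finset.sub1set Lx (fintype.subset_trans SM) // sEL.
  apply/eqP; rewrite finset.eqEsubset sK /=; apply/negPn/negP => nK.
  have xK : x \in (x |: S) <*> E.
    by apply: (fintype.subsetP (joing_subl _ _)); rewrite finset.setU11.
  have MK : M \subset (x |: S) <*> E.
    by rewrite -SE genS // finset.setSU // finset.subsetUr.
  have KM := maxM _ (_ : ((x |: S) <*> E)%G \proper L) MK.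
  move: Mx; rewrite -KM ?xK //.
  by rewrite properE sK.
Qed.

(** Descent from [L] through maximal subgroups containing [M]: each step divides the order by
    exactly p, so the order [p ^ t] is hit. *)
Lemma pgroup_intermediate p (M L : {group gT}) t : prime p -> p.-group L -> M \subset L ->
  (#|M| <= p ^ t <= #|L|)%N ->
  exists K : {group gT}, [/\ M \subset K, K \subset L & #|K| = (p ^ t)%N].
Proof.
move=> pp; have [n] := ubnP #|L|; elim: n L => // n IH L leLn pL sML /andP [leM leL].
move: leL; rewrite leq_eqVlt => /orP [/eqP eL|ltL]; first by exists L.
have [EL|[H mH sMH]] := maximal_exists sML.
  by move: (leq_ltn_trans leM ltL); rewrite EL ltnn.
have [/properP [sHL _] _] := maxgroupP mH.
have := Lagrange sHL; rewrite (p_maximal_index pL mH) => cL.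
have pH := pgroupS sHL pL.
have [k ck] := p_natP pH.
have [] := IH H _ pH sMH.
- rewrite ltnS in leLn; apply: leq_trans leLn; rewrite -cL.
  by rewrite -{1}[#|H|]muln1 ltn_pmul2l ?prime_gt1 ?cardG_gt0.
- rewrite leM /= ck leq_exp2l ?prime_gt1 //.
  by move: ltL; rewrite -cL ck -expnSr ltn_exp2l ?prime_gt1.
- by move=> K [MK KH cK]; exists K; split=> //; apply: fintype.subset_trans sHL.
Qed.

(** Lifts of [s] generators of L/E generate a supplement of order at most [p ^ (s + s * p ^ s)], and
    every subgroup between it and [L] is again a supplement. *)
Lemma supplement_of_order p (E L : {group gT}) s t : prime p -> p.-group L ->
  normal E L -> p.-abelem E -> #|L : E| = (p ^ s)%N ->
  (s + s * p ^ s <= t)%N -> (p ^ t <= #|L|)%N ->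
  exists M : {group gT}, [/\ M \subset L, M * E = L & #|M| = (p ^ t)%N].
Proof.
move=> pp pL nEL abE iLE st tL; have [sEL nLE] := andP nEL.
have [S [SL cS SE]] := pgroup_gen_over pp pL sEL iLE.
pose M := <<S>>%G; have sML : M \subset L by rewrite gen_subG.
have ME : M * E = L.
  by rewrite -norm_joinEl ?(fintype.subset_trans sML) // -SE joing_idl.
have nD : normal (M :&: E) M.
  by rewrite /normal finset.subsetIl normsI ?normG // (fintype.subset_trans sML).
have [Y cY DY] := finite_schreier (D := (M :&: E)%G) nD (erefl _).
have iM : #|M : M :&: E| = (p ^ s)%N.
  by rewrite -iLE -ME normC ?(fintype.subset_trans sML) // indexMg indexgI.
have abD : p.-abelem (M :&: E) := abelemS (finset.subsetIr _ _) abE.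
(* An elementary abelian group has order p to the minimal number of its generators, and Schreier
   bounds that number by the index [p ^ s] times [s]. *)
have cD : (#|M :&: E| <= p ^ (s * p ^ s))%N.
  rewrite (card_pgroup (abelem_pgroup abD)) leq_exp2l ?prime_gt1 //.
  rewrite -(rank_abelem abD) -grank_abelian ?(abelem_abelian abD) //= DY.
  rewrite (leq_trans (grank_min _)) // (leq_trans cY) // iM mulnC.
  by rewrite leq_mul.
have [|K [MK KL cK]] := pgroup_intermediate (M := M) (t := t) pp pL sML.
  rewrite tL andbT (leq_trans _ (leq_pexp2l (prime_gt0 pp) st)) //.
  by rewrite -(Lagrange (finset.subsetIl M E)) iM expnD mulnC leq_mul.
exists K; split=> //; apply/eqP; rewrite finset.eqEsubset mul_subG //= -ME.
exact: mulSg.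
Qed.

End FiniteGroups.

(** * Frattini subgroups *)

Section Frattini.
Variable G : topGroupType.
Implicit Types (A B H K N U : set G).
Hypotheses (cG : compact [set: G]) (hG : hausdorff_space G).

(* With a transversal rep of N in G, the Schreier generators
   rep x * s * (rep (x * s))^-1 generate a dense subgroup of N. *)
Lemma open_subgroup_fg N : is_normal N -> open N -> finitely_generated G ->
  exists n, tgen_by_n N n.
Proof.
move=> nN oN [_ [S _ GS]]; have sN := nN.1.
have [gT [f fq]] := finite_quotient cG nN oN.
(* The trivial class is represented by 1 so that [y (f 1) z] is [z] itself for z in [N]. *)
pose rep (q : gT) : G := if q == 1 then 1 else xget 1 (f @^-1` [set q]).
have repK x : f (rep (f x)) = f x.
  rewrite /rep; case: eqP => [->|_]; first exact: quot1 sN fq.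
  by case: xgetP => [z _ //|/(_ x) []].
pose y q s := rep q * s * (rep (q * f s))^-1.
pose Y := [seq y q s | q <- enum (fim f [set: G]), s <- S].
pose Gam := smallest (@is_subgroup G) [set` S].
pose Del := smallest (@is_subgroup G) [set` Y].
have sD : is_subgroup Del := is_subgroup_smallest _.
have [D1 DM DV] := sD.
pose Z := [set z | forall x, Del (y (f x) z)].
have sZ : is_subgroup Z.
  split=> [x|z w Zz Zw x|z Zz x].
  - by rewrite /y (quot1 sN fq) !mulg1 mulgV.
  - have -> : y (f x) (z * w) = y (f x) z * y (f (x * z)) w.
      by rewrite /y !(quot_mul fq) !mulgA mulgKV.
    by apply: DM.
  - have -> : y (f x) z^-1 = (y (f (x * z^-1)) z)^-1.
      by rewrite /y !invgM invgK -!(quot_mul fq) mulgKV mulgA.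
    exact: DV.
have GamZ : Gam `<=` Z.
  apply: smallest_sub => // s /= Ss x; apply: sub_gen_smallest => /=.
  by apply/allpairsP; exists (f x, s); split=> //=; rewrite mem_enum mem_fim.
have GamD : Gam `&` N `<=` Del.
  move=> z [/GamZ /(_ 1) + /(quot_ker fq) fz].
  by rewrite /y (quot1 sN fq) mul1g fz /rep eqxx mul1g invg1 mulg1.
have YN : [set` Y] `<=` N.
  move=> _ /= /allpairsP [[q s] /= [+ _ ->]]; rewrite mem_enum => /fimP [x _ <-].
  apply/(quot_ker fq); rewrite /y -(quot_mul fq x s) (quot_mul fq) (quot_inv sN fq).
  by rewrite (quot_mul fq (rep _)) !repK -(quot_mul fq) mulgV.
exists (size Y), Y => //; apply/seteqP; split.
  by apply: tgen_sub => //; apply: open_subgroup_closed.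
(* As [N] is open, the elements of the dense subgroup [Gam] approximating x can be taken in [N],
   where they lie in [Del]. *)
move=> x Nx U nU.
have : closure Gam x by have : [set: G] x by []; rewrite -GS.
move=> /(_ (U `&` N)) []; first by apply: filterI => //; apply: open_nbhs_nbhs.
by move=> z [Gz [Uz Nz]]; exists z; split => //; apply: GamD.
Qed.

Lemma is_normal_tgen A : (forall x y, A x -> A (x ^ y)) -> is_normal (tgen A).
Proof.
move=> AJ; split; first exact: is_subgroup_tgen.
have [t1 tM tV] := is_subgroup_tgen A.
move=> x y Ax; apply: (tgen_sub (H := [set x | tgen A (x ^ y)])) Ax.
- split=> /=; first by rewrite conj1g.
    by move=> u v; rewrite conjMg; apply: tM.
  by move=> u; rewrite conjVg; apply: tV.
- apply: preimage_closed; last exact: closed_closure.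
  move=> u _; rewrite /conjg.
  apply: (@cvg_comp _ _ _ (fun x : G => x * y) (fun z => y^-1 * z) _ (nbhs (u * y))).
    exact: (@mulgr_continuous G y).
  exact: (@mulgl_continuous G y^-1).
- by move=> u Au; apply: sub_tgen; apply: AJ.
Qed.

Lemma is_normal_setmulg A B : is_normal A -> is_normal B -> is_normal (setmulg A B).
Proof.
move=> [[A1 AM AV] AJ] [[B1 BM BV] BJ]; split; first split.
- by exists 1 => //; exists 1 => //; rewrite mulg1.
- move=> _ _ [a Aa [b Bb <-]] [c Ac [d Bd <-]]; exists (a * c); first exact: AM.
  exists (b ^ c * d); first by apply: BM => //; apply: BJ.
  by rewrite conjgE !mulgA mulgK.
- move=> _ [a Aa [b Bb <-]]; exists a^-1; first exact: AV.
  by exists (b^-1 ^ a^-1); [exact/BJ/BV | rewrite conjgE invgK invgM !mulgA mulVg mul1g].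
- move=> _ g [a Aa [b Bb <-]]; exists (a ^ g); first exact: AJ.
  by exists (b ^ g); [exact: BJ | rewrite -conjMg].
Qed.

(** The product is the continuous image of a compact set. This makes Frattini subgroups closed
    although their definition multiplies two closed subgroups without taking a closure. *)
Lemma closed_setmulg A B : closed A -> closed B -> closed (setmulg A B).
Proof.
move=> clA clB; apply: compact_closed => //.
have -> : setmulg A B = (fun z : G * G => z.1 * z.2) @` (A `*` B).
  apply/seteqP; split; first by move=> _ [a Aa [b Bb <-]]; exists (a, b).
  by move=> _ [[a b] /= [Aa Bb] <-]; exists a => //; exists b.
apply: continuous_compact.
  by apply: continuous_subspaceT; apply: mulg_continuous.
by apply: compact_setX; apply: subclosed_compact cG _.
Qed.

(** One step of [frattini_series], isolated so that it can be studied for any open normal [N];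
    [frattini_series p G i.+1] unfolds to it. *)
Definition frattini (p : nat) N : set G :=
  setmulg (tgen [set [~ x, y] | x in N & y in N]) (tgen [set x ^+ p | x in N]).

Variables (p : nat) (p_prime : prime p).
Section OneSubgroup.
Variable N : set G.
Hypotheses (nN : is_normal N) (oN : open N).
Let sN : is_subgroup N := nN.1.
Let clN : closed N := open_subgroup_closed sN oN.
Local Notation Phi := (frattini p N).

Lemma is_normal_frattini : is_normal Phi.
Proof.
apply: is_normal_setmulg; apply: is_normal_tgen.
  move=> _ g [x Nx [y Ny <-]]; exists (x ^ g); first exact: nN.2.
  by exists (y ^ g); [exact: nN.2 | rewrite -conjRg].
by move=> _ g [x Nx <-]; exists (x ^ g); [exact: nN.2 | rewrite conjXg].
Qed.

Lemma closed_frattini : closed Phi.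
Proof. by apply: closed_setmulg; apply: closed_closure. Qed.

Lemma subgroupX x n : N x -> N (x ^+ n).
Proof.
move=> Nx; have [N1 NM _] := sN.
by elim: n => [//|n IH]; rewrite expgS; apply: (NM).
Qed.

Lemma frattini_sub : Phi `<=` N.
Proof.
have [N1 NM NV] := sN; move=> _ [a Aa [b Bb <-]]; apply: (NM).
  apply: tgen_sub Aa => // _ [x Nx [y Ny <-]]; rewrite commgEl.
  by apply: NM; [exact: NV | exact: nN.2].
by apply: tgen_sub Bb => // _ [x Nx <-]; apply: subgroupX.
Qed.

Lemma frattini_comm x y : N x -> N y -> Phi [~ x, y].
Proof.
move=> Nx Ny; exists [~ x, y]; first by apply: sub_tgen; exists x => //; exists y.
by exists 1; rewrite ?mulg1 //; case: (is_subgroup_tgen [set x ^+ p | x in N]).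
Qed.

Lemma frattini_exp x : N x -> Phi (x ^+ p).
Proof.
move=> Nx; exists 1; last first.
  by exists (x ^+ p); rewrite ?mul1g //; apply: sub_tgen; exists x.
by case: (is_subgroup_tgen [set [~ x, y] | x in N & y in N]).
Qed.

(** Modulo [Phi] the group [N] is abelian of exponent p. So [A] is normalised by [N] and contains
    the p-th power of x, and the p cosets of [A] by powers of x form a group. *)
Lemma subgroup_adjoin A x : is_subgroup A -> Phi `<=` A -> A `<=` N -> N x ->
  is_subgroup [set z | exists2 e : nat, (e < p)%N & A ((x ^+ e)^-1 * z)].
Proof.
move=> sA PA AN Nx; have [A1 AM AV] := sA.
have AX q a : A a -> A (a ^+ q).
  by move=> Aa; elim: q => [//|q IH]; rewrite expgS; apply: (AM).
have AJ a g : A a -> N g -> A (a ^ g).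
  move=> Aa Ng; have -> : a ^ g = a * [~ a, g] by rewrite commgEl mulKVg.
  by apply: (AM) => //; apply/PA/frattini_comm => //; apply: AN.
have Xp q : A (x ^+ (p * q)) by rewrite expgM; apply/AX/PA/frattini_exp.
have red e z : A ((x ^+ e)^-1 * z) ->
    exists2 e : nat, (e < p)%N & A ((x ^+ e)^-1 * z).
  move=> Az; exists (e %% p)%N; first by rewrite ltn_mod prime_gt0.
  have -> : (x ^+ (e %% p))^-1 * z = x ^+ (p * (e %/ p)) * ((x ^+ e)^-1 * z).
    rewrite {3}(divn_eq e p) addnC (mulnC (e %/ p)) expgnDr invgM -mulgA.
    by rewrite mulKVg.
  exact: AM.
split.
- by exists 0%N; rewrite ?prime_gt0 // expg0 invg1 mul1g.
- move=> z w [e _ Az] [f _ Aw]; apply: (red (e + f)%N).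
  have -> : (x ^+ (e + f))^-1 * (z * w) =
      ((x ^+ e)^-1 * z) ^ (x ^+ f) * ((x ^+ f)^-1 * w).
    by rewrite expgnDr invgM conjgE !mulgA mulgK.
  by apply: AM => //; apply: AJ => //; apply: subgroupX.
(* The exponent [e * p.-1] stands for -e, since it differs from it by [p * e] and [x ^+ (p * e)]
   lies in [A]. *)
- move=> z [e _ Az]; apply: (red (e * p.-1)%N).
  have -> : (x ^+ (e * p.-1))^-1 * z^-1 =
      (x ^+ (p * e))^-1 * ((x ^+ e)^-1 * z)^-1 ^ (x ^+ e)^-1.
    have -> : (p * e = e + e * p.-1)%N.
      by rewrite mulnC -{1}(prednK (prime_gt0 p_prime)) mulnS.
    rewrite expgnDr !invgM conjgE.
    by rewrite !invgK !mulgA mulgKV mulgK.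
  apply: (AM); first by apply: AV; apply: Xp.
  by apply: AJ; [apply: AV | case: sN => _ _ NV; apply/NV/subgroupX].
Qed.

(** The elements of [S] are adjoined to [Phi] one at a time, each multiplying the list of coset
    representatives by p powers; the resulting subgroup is a finite union of cosets. *)
Lemma frattini_cosets (S : seq G) : [set` S] `<=` N ->
  exists F : seq G, [/\ [set` F] `<=` N, is_subgroup (setmulg [set` F] Phi),
    Phi `<=` setmulg [set` F] Phi & [set` S] `<=` setmulg [set` F] Phi].
Proof.
have [[P1 PM PV] PJ] := is_normal_frattini.
elim: S => [|x S IH] SN.
  have P1E : setmulg [set` [:: 1 : G]] Phi = Phi.
    apply/seteqP; split=> [z [y /=]|z Pz].
      by rewrite inE => /eqP -> [u Pu <-]; rewrite mul1g.
    by exists 1; rewrite /= ?mem_head //; exists z; rewrite ?mul1g.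
  exists [:: 1]; rewrite P1E; split=> //.
  by move=> y /=; rewrite inE => /eqP ->; case: sN.
have [|F [FN sF PF SF]] := IH; first by move=> y yS; apply: SN; rewrite /= inE yS orbT.
have Nx : N x by apply: SN; rewrite /= mem_head.
have FPN : setmulg [set` F] Phi `<=` N.
  have [_ NM _] := sN; move=> _ [u Fu [v Pv <-]].
  by apply: NM; [apply: FN | apply: frattini_sub].
have := subgroup_adjoin sF PF FPN Nx.
exists [seq x ^+ e * u | e <- iota 0 p, u <- F].
have -> : setmulg [set` [seq x ^+ e * u | e <- iota 0 p, u <- F]] Phi =
  [set z | exists2 e : nat, (e < p)%N & setmulg [set` F] Phi ((x ^+ e)^-1 * z)].
  apply/seteqP; split=> z.
    move=> [_ /= /allpairsP [[e u] /= [+ Fu ->]] [v Pv <-]].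
    rewrite mem_iota => ep; exists e => //; exists u => //; exists v => //.
    by rewrite -mulgA mulKg.
  move=> [e ep [u Fu [v Pv uv]]]; exists (x ^+ e * u).
    by apply/allpairsP; exists (e, u); rewrite mem_iota.
  by exists v; rewrite // -mulgA uv mulKVg.
split=> //.
- move=> _ /= /allpairsP [[e u] /= [_ Fu ->]]; case: sN => _ NM _; apply: NM.
    exact: subgroupX.
  exact: FN.
- by move=> z Pz; exists 0%N; rewrite ?prime_gt0 // expg0 invg1 mul1g; apply: PF.
- move=> y /=; rewrite inE => /orP [/eqP ->|yS].
    by exists 1%N; rewrite ?prime_gt1 // expg1 mulVg; case: sF.
  by exists 0%N; rewrite ?prime_gt0 // expg0 invg1 mul1g; apply: SF.
Qed.

(** A finite union of cosets of the closed subgroup [Phi] is closed. Being a subgroup containing the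
    generators, the one from [frattini_cosets] contains all of [N], so [Phi] has finite index in
    [N]. *)
Lemma open_frattini n : tgen_by_n N n -> open Phi.
Proof.
move=> [S _ NS]; have [|F [FN sF _ SF]] := @frattini_cosets S.
  by rewrite -NS; apply: sub_tgen.
have clF (s : seq G) : closed (setmulg [set` s] Phi).
  have -> : setmulg [set` s] Phi = \bigcup_(x in [set` s]) [set z | Phi (x^-1 * z)].
    apply/seteqP; split.
      by move=> _ [x sx [z Pz <-]]; exists x => //=; rewrite mulKg.
    by move=> z [x sx Pz]; exists x => //; exists (x^-1 * z); rewrite ?mulKVg.
  apply: closed_bigcup => [|x _]; first exact: finite_seq.
  by apply: closed_mulgl; exact: closed_frattini.
have NF : N `<=` setmulg [set` F] Phi by rewrite -{1}NS; apply: tgen_sub => //; apply: clF.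
have [[P1 PM PV] _] := is_normal_frattini.
(* [Phi] is what remains of the open set [N] once the finitely many other cosets, a closed set, are
   removed. *)
have -> : Phi = N `&` ~` setmulg [set` [seq x <- F | x \notin Phi]] Phi.
  apply/seteqP; split=> z.
    move=> Pz; split; first exact: frattini_sub.
    move=> [x /=]; rewrite mem_filter => /andP [/negP nPx _] [u Pu xu]; apply: nPx.
    by rewrite inE -(mulgK u x) xu; apply: (PM) => //; apply: (PV).
  move=> [/NF [x Fx [u Pu <-]] nx]; apply: PM => //; apply: contrapT => nPx.
  apply: nx; exists x; last by exists u.
  by rewrite /= mem_filter Fx andbT; apply/negP; rewrite inE.
by apply: openI => //; apply: closed_openC; apply: clF.
Qed.

End OneSubgroup.
End Frattini.

(** * Frattini generation in pro-p groups *)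

Section Index.
Variables (G : topGroupType) (N : set G) (gT : finGroupType) (f : G -> gT).
Hypotheses (sN : is_subgroup N) (fq : is_quotient N f).

Lemma mem_fim_subgroup H x : is_subgroup H -> N `<=` H -> (f x \in fim f H) <-> H x.
Proof.
move=> sH NH; split=> [|Hx]; last exact: mem_fim.
move=> /fimP [y Hy /(quot_eq sN fq)/NH Hyx].
by rewrite -(mulKVg y x); case: sH => _ HM _; apply: HM.
Qed.

Lemma sub_index_index (A H : set G) : is_subgroup A -> is_subgroup H -> N `<=` H ->
  sub_index A H = #|fim f A : fim f H|.
Proof.
move=> sA sH NH.
have gA := group_set_fim sN fq sA; have gH := group_set_fim sN fq sH.
rewrite -(card_lcosets (group gA) (group gH)) /=.
rewrite (sub_indexE (f := fun x => f x *: fim f H)) //.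
  congr #|pred_of_set _|; apply/setP => C; apply/fimP/lcosetsP.
    by move=> [x Ax <-]; exists (f x) => //; apply: mem_fim.
  by move=> [_ /fimP [x Ax <-] ->]; exists x.
move=> x y; rewrite -(mem_fim_subgroup _ sH NH) (quot_mul fq) (quot_inv sN fq).
rewrite -(mem_lcoset (fim f H)).
split=> [->|]; first by apply: (lcoset_refl (group gH)).
by move/(lcoset_eqP (G := group gH)).
Qed.

End Index.

Lemma decreasing_sets (T : Type) (A : nat -> set T) :
  (forall n, A n.+1 `<=` A n) -> forall k m, (k <= m)%N -> A m `<=` A k.
Proof.
move=> AS k m /subnK <-; elim: (m - k)%N => // d IH.
by rewrite addSn; apply: subset_trans (AS _) IH.
Qed.

(** * Intersections of descending chains of supplements *)

Section Limit.
Variable G : topGroupType.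
Hypothesis cG : compact [set: G].

(** For x in [L n], the supplement property lets one correct x inside [x N n] to an element of
    [L (n + m)] for every m. By compactness the nested closed sets [A m] have a common point, which
    lies in all [L i] and in the coset of x. *)
Lemma bigcap_supplement (L N : nat -> set G) :
  (forall n, is_subgroup (L n)) -> (forall n, closed (L n)) ->
  (forall n, is_subgroup (N n)) -> (forall n, closed (N n)) ->
  (forall n, N n.+1 `<=` N n) -> (forall n, setmulg (L n.+1) (N n) = L n) ->
  forall n, setmulg (\bigcap_i L i) (N n) = L n.
Proof.
move=> sL cL sN cN NS LN n.
have NL k : N k `<=` L k.
  move=> x Nx; rewrite -LN; exists 1; first by case: (sL k.+1).
  by exists x; rewrite ?mul1g.
have LS k : L k.+1 `<=` L k.
  move=> x Lx; rewrite -LN; exists x => //.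
  by exists 1; rewrite ?mulg1 //; case: (sN k).
have Lle k m : (k <= m)%N -> L m `<=` L k.
  exact: decreasing_sets.
have Nle k m : (k <= m)%N -> N m `<=` N k.
  exact: decreasing_sets.
apply/seteqP; split.
  move=> _ [x Lx [y Ny <-]]; case: (sL n) => _ LM _; apply: LM; last exact: NL.
  exact: Lx.
move=> x Lx; pose A m := L (n + m)%N `&` [set y | N n (x^-1 * y)].
have A0 m : A m !=set0.
  elim: m => [|m [y [Ly Ny]]].
    by exists x; split; rewrite ?addn0 //= mulVg; case: (sN n).
  move: (Ly); rewrite -LN => -[z Lz [w Nw zw]]; exists z; split; first by rewrite addnS.
  have [_ NM NV] := sN n; rewrite /=.
  have -> : x^-1 * z = x^-1 * y * w^-1 by rewrite -zw mulgA mulgK.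
  by apply: NM => //; apply: NV; apply: Nle Nw; rewrite leq_addr.
have cA m : closed (A m) by apply: closedI => //; apply: closed_mulgl.
have AS k m : (k <= m)%N -> A m `<=` A k.
  by move=> km y [Ly Ny]; split=> //; apply: Lle Ly; rewrite leq_add2l.
pose F := filter_from [set: nat] A.
have FF : Filter F.
  apply: filter_from_filter; first by exists 0%N.
  move=> i j _ _; exists (maxn i j) => // y Ay.
  by split; apply: AS Ay; rewrite ?leq_maxl ?leq_maxr.
have PF : ProperFilter F by apply: filter_from_proper.
have [|y [_ cly]] := cG PF; first exact: filterT.
have Ay m : A m y.
  rewrite (_ : A m = closure (A m)); last by apply/closure_id.
  by move: cly; rewrite clusterE; apply; exists m.
exists y; first by move=> m _; have [+ _] := Ay m; apply: Lle; rewrite leq_addl.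
exists (y^-1 * x); last by rewrite mulKVg.
have [_ Nxy] := Ay 0%N; have [_ _ NV] := sN n.
by have := NV _ Nxy; rewrite invgM invgK.
Qed.

End Limit.

Section ProP.
Variables (p : nat) (p_prime : prime p) (G : topGroupType).
Hypothesis (G_prop : pro_p p G).
Let cG : compact [set: G]. Proof. by case: G_prop. Qed.
Let hG : hausdorff_space G. Proof. by case: G_prop. Qed.
Let tG : totally_disconnected [set: G]. Proof. by case: G_prop. Qed.

Lemma is_subgroup_setT : is_subgroup [set: G].
Proof. by []. Qed.

Section Quot.
Variables (N : set G) (gT : finGroupType) (f : G -> gT).
Hypotheses (nN : is_normal N) (oN : open N) (fq : is_quotient N f).

Lemma pgroup_fim A : is_subgroup A -> p.-group (fim f A).
Proof.
move=> sA.
have : p.-group (fim f [set: G]).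
  have [_ _ _ /(_ N nN oN) [k]] := G_prop.
  rewrite (sub_index_quot nN.1 fq) => ck; rewrite /pgroup ck.
  by rewrite pnatX pnat_id.
by apply: (@pgroupS _ _ (group (group_set_fim nN.1 fq is_subgroup_setT))
  (group (group_set_fim nN.1 fq sA))); apply: fimS.
Qed.

(** In a finite p-group the Frattini subgroup is the join of the derived subgroup and the p-th
    powers. *)
Lemma fim_frattini M : is_normal M -> fim f (frattini p M) \subset 'Phi(fim f M).
Proof.
move=> [sM nM]; have gM := group_set_fim nN.1 fq sM.
rewrite (Phi_joing (P := group gM) (pgroup_fim sM)) /=.
rewrite (fim_setmulg fq) !(fim_tgen nN.1 fq _ oN).
apply: mul_subG; rewrite gen_subG; apply/fintype.subsetP => t /fimP.
  move=> [_ [x Mx [y My <-]] <-]; apply: (fintype.subsetP (joing_subl _ _)).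
  by rewrite (quot_comm nN.1 fq) derg1 mem_commg // mem_fim.
move=> [_ [x Mx <-] <-]; apply: (fintype.subsetP (joing_subr _ _)).
rewrite (quot_exp nN.1 fq) -{1}[p]expn1 Mho_p_elt ?mem_fim //.
by apply: (mem_p_elt (pgroup_fim sM : p.-group (group gM))); apply: mem_fim.
Qed.

End Quot.

(** Elements of the Frattini subgroup are non-generators. A point of [N] outside the closed set
    [tgen X] would stay outside modulo some open normal [U], against the finite statement in G/U. *)
Lemma tgen_frattini N (X : set G) : is_normal N -> open N -> X `<=` N ->
  N `<=` setmulg (tgen X) (frattini p N) -> tgen X = N.
Proof.
move=> nN oN XN NX; have sN := nN.1.
apply/seteqP; split; first by apply: tgen_sub => //; apply: open_subgroup_closed.
move=> x Nx; apply: contrapT => nKx.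
have nU : nbhs 1 [set u | ~ tgen X (x * u)].
  apply: open_nbhs_nbhs; split; last by rewrite /= mulg1.
  by apply: (@open_mulgl G x (~` tgen X)); apply/closed_openC/closed_closure.
have [U [nU' oU UX]] := open_normal_basis cG hG tG nU.
have [gT [f fq]] := finite_quotient cG nU' oU.
have gN := group_set_fim nU'.1 fq sN.
have gK := group_set_fim nU'.1 fq (is_subgroup_tgen X).
have KN : tgen X `<=` N by apply: tgen_sub => //; apply: open_subgroup_closed.
have : 'Phi(fim f N) <*> fim f (tgen X) = group gN.
  apply/eqP; rewrite finset.eqEsubset join_subG (Phi_sub (group gN)) (fimS f KN) /=.
  apply: fintype.subset_trans (fimS f NX) _; rewrite (fim_setmulg fq).
  rewrite mul_subG ?joing_subr //; apply: fintype.subset_trans (joing_subl _ _).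
  exact: (fim_frattini nU' oU fq nN).
move/(Phi_nongen (G := group gN)) => E.
have : f x \in <<fim f (tgen X)>> by rewrite E; apply: mem_fim.
rewrite (genGid (group gK)) => /fimP [k Kk /esym /(quot_eq nU'.1 fq) /UX].
by rewrite /= mulKVg.
Qed.

(** At most [d] generators of the finite quotient by the Frattini subgroup are lifted to [N], where
    they generate by [tgen_frattini]. *)
Lemma tgen_by_index (N : set G) d : is_normal N -> open N -> open (frattini p N) ->
  sub_index N (frattini p N) = (p ^ d)%N -> exists2 n, (n <= d)%N & tgen_by_n N n.
Proof.
move=> nN oN oP iN; have nP := is_normal_frattini p nN.
have [gT [f fq]] := finite_quotient cG nP oP.
have gN := group_set_fim nP.1 fq nN.1.
have [|S [SN cS SE]] := pgroup_gen_over (s := d) p_prime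
    (pgroup_fim nP oP fq nN.1 : p.-group (group gN)) (sub1G _).
  by rewrite indexg1 -iN (sub_index_quot nP.1 fq).
pose s := [seq xget 1 [set x | N x /\ f x = q] | q <- enum S].
have sP q : q \in S -> N (xget 1 [set x | N x /\ f x = q]) /\
    f (xget 1 [set x | N x /\ f x = q]) = q.
  move=> Sq; have /fimP [x Nx fx] := fintype.subsetP SN _ Sq.
  by case: xgetP => [y _ //|/(_ x) []].
exists (size s); first by rewrite size_map -cardE.
exists s => //; apply: tgen_frattini => // [_ /= /mapP [q + ->]|x Nx].
  by rewrite mem_enum => /sP [].
have fs : fim f [set` s] = S.
  apply/setP => q; apply/fimP/idP => [[_ /= /mapP [r + ->] <-]|Sq].
    by rewrite mem_enum => /[dup] Sr /sP [_ ->].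
  exists (xget 1 [set x | N x /\ f x = q]); last by case: (sP q Sq).
  by apply/mapP; exists q; rewrite ?mem_enum.
have : f x \in fim f (tgen [set` s]).
  rewrite (fim_tgen nP.1 fq _ oP) fs.
  have -> : <<S>> = group gN by rewrite -SE -joing_idl joingG1.
  exact: mem_fim.
move=> /fimP [k Kk /(quot_eq nP.1 fq) Pkx]; exists k => //.
by exists (k^-1 * x); rewrite ?mulKVg.
Qed.

Hypothesis (G_fg : finitely_generated G).
Local Notation Phi := (frattini_series p G).

(** Openness of the next term requires finite generation of [Phi i], which as an open subgroup
    inherits it from [G] by Schreier. *)
Lemma frattini_series_open_normal i : is_normal (Phi i) /\ open (Phi i).
Proof.
elim: i => [|i [nP oP]].
  by split; [split | exact: openT].
split; first exact: (is_normal_frattini p nP).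
have [n Pn] := open_subgroup_fg cG nP oP G_fg.
exact: (open_frattini cG hG p_prime nP oP Pn).
Qed.

Lemma frattini_seriesS i : Phi i.+1 `<=` Phi i.
Proof. by apply: frattini_sub; case: (frattini_series_open_normal i). Qed.

End ProP.

(** * Growth of the Frattini quotients *)

Section Growth.
Variables (R : realType) (p : nat) (p_prime : prime p).
Local Open Scope ring_scope.

(** The factor 4 absorbs small cases such as [c = 3]. A quadratic bound is enough to make p ^ c
    outgrow every linear function. *)
Lemma sqr_le_expn c : (c ^ 2 <= 4 * 2 ^ c)%N.
Proof.
elim: c => // c IH; have := ltn_expl c (isT : (1 < 2)%N); rewrite -!mulnn expnS in IH *.
  by move: (2 ^ c)%N IH => m; nia.
Qed.

(** The truncated difference is forced to be positive, so [l] is strictly increasing. *)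
Lemma leq_id_growth (rho : R) (l : nat -> nat) : 0 < rho ->
  (forall i, rho * (p ^ l i)%:R + 1 <= (l i.+1 - l i)%:R) ->
  forall i, (i <= l i)%N.
Proof.
move=> r0 lr; elim=> // i IH; apply: (leq_ltn_trans IH).
rewrite -subn_gt0 -(ltr_nat R); apply: lt_le_trans (lr i).
by rewrite ltr_wpDl // mulr_ge0 // ltW.
Qed.

(* With s = truncn (a * l) and c = l - s, the bound follows from
   2 l <= a * rho * p ^ c, where p ^ c >= c ^ 2 / 4 and c >= (1 - a) l. *)
Lemma truncn_growth (a rho : R) (l : nat -> nat) : 0 < a < 1 -> 0 < rho ->
  (forall i, (l i <= l i.+1)%N) ->
  (forall i, rho * (p ^ l i)%:R + 1 <= (l i.+1 - l i)%:R) ->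
  exists n0, forall n, (n0 <= n)%N ->
    let s := Num.truncn (a * (l n)%:R) in let t := Num.truncn (a * (l n.+1)%:R) in
    (s + s * p ^ s <= t)%N /\ (t <= s + (l n.+1 - l n))%N.
Proof.
move=> /andP [a0 a1] r0 lS lr.
have ln := leq_id_growth r0 lr.
pose k := a * rho * (1 - a) ^+ 2.
have k0 : 0 < k by rewrite !mulr_gt0 ?subr_gt0.
(* Here 8 is 2 times the 4 of the quadratic bound: [2 * L <= a * rho * p ^ c] follows from
   [8 <= k * L], which holds once [n > 8 / k] because [n <= l n]. *)
exists (Num.truncn (8 / k)).+1 => n nn s t.
set L := l n; set d := (l n.+1 - l n)%N.
have l'E : l n.+1 = (L + d)%N by rewrite /d subnKC ?lS.
have [sl sl1] : s%:R <= a * L%:R /\ a * L%:R < s.+1%:R :> R.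
  by apply/andP; apply: truncn_itv; rewrite mulr_ge0 // ltW.
have sL : (s <= L)%N.
  rewrite -(ler_nat R); apply: (le_trans sl).
  by rewrite ler_piMl // ltW.
have kL : 8 <= k * L%:R.
  rewrite -ler_pdivrMl // mulrC; apply: ltW; apply: lt_le_trans (_ : n%:R <= _).
    have /andP [_] := truncn_itv (ltW (divr_gt0 (ltr0n R 8) k0)).
    by move=> /lt_le_trans; apply; rewrite ler_nat.
  by rewrite ler_nat.
have dr : rho * (p ^ L)%:R <= d%:R.
  by apply: le_trans (lr n); rewrite lerDl.
split; last first.
  rewrite /t truncn_le_nat l'E natrD mulrDr -addSn natrD.
  by rewrite ltr_leD // ler_piMl // ltW.
pose c := (L - s)%N; have LE : L = (s + c)%N by rewrite /c subnKC.
have cL : (1 - a) * L%:R <= c%:R.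
  by rewrite /c natrB // mulrBl mul1r lerD2l lerN2.
have pc : 2 * L%:R <= a * rho * (p ^ c)%:R :> R.
  have c4 : (1 - a) ^+ 2 * L%:R ^+ 2 <= 4 * (p ^ c)%:R.
    apply: (@le_trans _ _ (c%:R ^+ 2)).
      by rewrite -exprMn lerXn2r // nnegrE ?mulr_ge0 // subr_ge0 ltW.
    rewrite -natrX -natrM ler_nat (leq_trans (sqr_le_expn c)) // leq_mul //.
    have [->|c0] := posnP c; first by rewrite !expn0.
    by rewrite leq_exp2r ?prime_gt1.
  have H1 : 8 * L%:R <= k * L%:R * L%:R :> R by apply: ler_wpM2r.
  have H2 : a * rho * ((1 - a) ^+ 2 * L%:R ^+ 2) <= a * rho * (4 * (p ^ c)%:R).
    by apply: ler_wpM2l => //; rewrite mulr_ge0 // ltW.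
  have E : k * L%:R * L%:R = a * rho * ((1 - a) ^+ 2 * L%:R ^+ 2) by rewrite /k; ring.
  lra.
rewrite /t truncn_ge_nat ?mulr_ge0 ?(ltW a0) // l'E.
have p1 : 1 <= (p ^ s)%:R :> R by rewrite ler1n expn_gt0 prime_gt0.
have H1 : (s + s * p ^ s)%:R <= 2 * L%:R * (p ^ s)%:R :> R.
  by rewrite -!natrM ler_nat; move: p1; rewrite ler1n; nia.
have H2 : 2 * L%:R * (p ^ s)%:R <= a * rho * (p ^ c)%:R * (p ^ s)%:R.
  by apply: ler_wpM2r.
have H3 : a * (rho * (p ^ L)%:R) <= a * d%:R by apply: ler_wpM2l => //; apply: ltW.
have E : a * rho * (p ^ c)%:R * (p ^ s)%:R = a * (rho * (p ^ L)%:R).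
  by rewrite LE expnD natrM; ring.
have H4 : a * d%:R <= a * (L + d)%:R.
  by apply: ler_wpM2l; [exact: ltW | rewrite ler_nat leq_addl].
by apply: (le_trans H1); apply: (le_trans H2); rewrite E; apply: (le_trans H3).
Qed.

End Growth.

(** * Closed subgroups of prescribed order modulo the Frattini series *)

Section Tower.
Variables (p : nat) (p_prime : prime p) (G : topGroupType).
Hypotheses (G_prop : pro_p p G) (G_fg : finitely_generated G).
Local Notation Phi := (frattini_series p G).
Let cG : compact [set: G]. Proof. by case: G_prop. Qed.
Let nPhi i : is_normal (Phi i).
Proof. by case: (frattini_series_open_normal p_prime G_prop G_fg i). Qed.
Let oPhi i : open (Phi i).
Proof. by case: (frattini_series_open_normal p_prime G_prop G_fg i). Qed.
Let sPhi i : is_subgroup (Phi i) := (nPhi i).1.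
Let PhiS i : Phi i.+1 `<=` Phi i.
Proof. exact: frattini_seriesS. Qed.

(** The p-adic valuation is the full logarithm here, since the index is a power of p. *)
Definition flog (i : nat) := logn p (sub_index [set: G] (Phi i)).

Lemma sub_index_frattini i : sub_index [set: G] (Phi i) = (p ^ flog i)%N.
Proof.
have [_ _ _ /(_ _ (nPhi i) (oPhi i)) [k E]] := G_prop.
by rewrite /flog E pfactorK.
Qed.

Lemma flog_step i : (flog i <= flog i.+1)%N /\
  sub_index (Phi i) (Phi i.+1) = (p ^ (flog i.+1 - flog i))%N.
Proof.
have [gT [f fq]] := finite_quotient cG (nPhi i.+1) (oPhi i.+1).
have gA := group_set_fim (sPhi i.+1) fq (is_subgroup_setT G).
have gE := group_set_fim (sPhi i.+1) fq (sPhi i).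
have := Lagrange (fimS f (@subsetT _ (Phi i)) : group gE \subset group gA).
rewrite /= -(sub_index_index (sPhi i.+1) fq (is_subgroup_setT G) (sPhi i)) //.
rewrite -!(sub_index_quot (sPhi i.+1) fq) !sub_index_frattini => E.
have ll : (flog i <= flog i.+1)%N.
  by rewrite -(dvdn_Pexp2l _ _ (prime_gt1 p_prime)) -E dvdn_mull.
split=> //; apply/eqP; rewrite -(eqn_pmul2r (_ : 0 < p ^ flog i)%N) ?E.
  by rewrite -expnD subnK.
by rewrite expn_gt0 prime_gt0.
Qed.

Section Step.
Variables (i : nat) (L : set G).
Hypotheses (sL : is_subgroup L) (PL : Phi i `<=` L).

(** The recursive step: [supplement_of_order] is applied in the quotient by [Phi i.+1], with [E] the
    image of [Phi i], and the result is pulled back. The upper bound on [t] says that [p ^ t] does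
    not exceed the order of the image of [L]. *)
Lemma frattini_supplement s t : sub_index L (Phi i) = (p ^ s)%N ->
  (s + s * p ^ s <= t)%N -> (t <= s + (flog i.+1 - flog i))%N ->
  exists L', [/\ is_subgroup L', Phi i.+1 `<=` L', setmulg L' (Phi i) = L &
    sub_index L' (Phi i.+1) = (p ^ t)%N].
Proof.
move=> iL st ts.
have [gT [f fq]] := finite_quotient cG (nPhi i.+1) (oPhi i.+1).
have gL := group_set_fim (sPhi i.+1) fq sL.
have gE := group_set_fim (sPhi i.+1) fq (sPhi i).
have pL : p.-group (group gL) := pgroup_fim p_prime G_prop (nPhi i.+1) (oPhi i.+1) fq sL.
have iLE : #|group gL : group gE| = (p ^ s)%N.
  by rewrite -(sub_index_index (sPhi i.+1) fq sL (sPhi i)).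
have P1L : Phi i.+1 `<=` L by apply: subset_trans PL; apply: PhiS.
have sEL : group gE \subset group gL := fimS f PL.
have [|||M [ML ME cM]] := supplement_of_order p_prime pL _ _ iLE st.
- rewrite /normal sEL; apply/normsP => _ /fimP [x Lx <-] /=.
  apply/eqP; rewrite eqEcard cardJg leqnn andbT.
  apply/fintype.subsetP => _ /imsetP [_ /fimP [y Py <-] ->].
  by rewrite -(quot_conj (sPhi i.+1) fq) mem_fim //; apply: (nPhi i).2.
- rewrite abelemE //; apply/andP; split.
    apply/centsP => _ /fimP [x Px <-] _ /fimP [y Py <-]; apply/commgP.
    rewrite -(quot_comm (sPhi i.+1) fq); apply/eqP/(quot_ker fq).
    exact: frattini_comm.
  apply/exponentP => _ /fimP [x Px <-].
  rewrite -(quot_exp (sPhi i.+1) fq); apply/(quot_ker fq).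
  exact: frattini_exp.
- rewrite -(Lagrange sEL) iLE /= -(sub_index_quot (sPhi i.+1) fq).
  by rewrite (flog_step i).2 mulnC -expnD leq_exp2l ?prime_gt1.
have MG : M \subset fim f [set: G].
  by apply: fintype.subset_trans ML _; apply: fimS.
exists [set x | f x \in M]; split.
- exact: (preim_quot_subgroup (sPhi i.+1) fq).
- by move=> x /(quot_ker fq) /= ->; rewrite group1.
- apply/seteqP; split.
    move=> z [x /= /(fintype.subsetP ML) /(mem_fim_subgroup (sPhi i.+1) fq _ sL P1L) Lx].
    move=> [y Py <-]; case: (sL) => _ LM _; apply: LM; last exact: PL.
    by apply: Lx; apply: subset_trans (PhiS i) PL.
  move=> x Lx; have : f x \in group gL by apply: mem_fim.
  rewrite -ME => /mulsgP [m _ Mm /fimP [y Py <-] fx].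
  exists (x * y^-1); last by exists y; rewrite ?mulgKV.
  by rewrite /= (quot_mul fq) (quot_inv (sPhi i.+1) fq) fx mulgK.
- by rewrite (sub_index_quot (sPhi i.+1) fq) (fim_preim MG).
Qed.

End Step.

(** Provides the subgroup from which the recursion starts. *)
Lemma frattini_intermediate i t : (t <= flog i)%N ->
  exists L, [/\ is_subgroup L, Phi i `<=` L & sub_index L (Phi i) = (p ^ t)%N].
Proof.
move=> ti; have [gT [f fq]] := finite_quotient cG (nPhi i) (oPhi i).
have gA := group_set_fim (sPhi i) fq (is_subgroup_setT G).
have pA : p.-group (group gA) :=
  pgroup_fim p_prime G_prop (nPhi i) (oPhi i) fq (is_subgroup_setT G).
have [|M [_ MG cM]] := pgroup_intermediate (t := t) p_prime pA (sub1G _).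
  rewrite cards1 expn_gt0 prime_gt0 //= -(sub_index_quot (sPhi i) fq).
  by rewrite sub_index_frattini leq_exp2l ?prime_gt1.
exists [set x | f x \in M]; split.
- exact: (preim_quot_subgroup (sPhi i) fq).
- by move=> x /(quot_ker fq) /= ->; rewrite group1.
- by rewrite (sub_index_quot (sPhi i) fq) (fim_preim MG).
Qed.

Section RankGradient.
Variable R : realType.
Local Open Scope ring_scope.

(** Here rho is the rank gradient itself: [Phi i] has index [p ^ flog i] and needs at most
    [flog i.+1 - flog i] generators, so it bounds the infimum from above. *)
Lemma rank_gradient_growth : (0 < rank_gradient R G)%E ->
  exists2 rho : R, 0 < rho &
    forall i, rho * (p ^ flog i)%:R + 1 <= (flog i.+1 - flog i)%:R.
Proof.
move=> rg0.
have le_rg (N : set G) n : is_normal N -> open N -> tgen_by_n N n ->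
    (rank_gradient R G <= ((n%:R - 1) / (sub_index [set: G] N)%:R)%:E)%E.
  move=> nN oN Nn; apply: (le_trans (y :=
      ((gen_number R N - 1) * ((sub_index [set: G] N)%:R^-1)%:E)%E)).
    by apply: ereal_inf_lbound; exists N => //; split=> //; case: nN.
  rewrite EFinM; apply: lee_wpmul2r; first by rewrite lee_fin invr_ge0.
  rewrite EFinB; apply: leeB => //; apply: ereal_inf_lbound.
  by exists n.
(* The finitely generated subgroup [G = Phi 0] already gives a finite upper bound. *)
have fin : rank_gradient R G \is a fin_num.
  rewrite gt0_fin_numE //; have [n Gn] := G_fg.
  by apply: le_lt_trans (le_rg _ _ (nPhi 0) (oPhi 0) Gn) (ltry _).
exists (fine (rank_gradient R G)).
  by rewrite fine_gt0 // rg0 ltey_eq fin.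
move=> i; have [_ iE] := flog_step i.
have [n nd Nn] := tgen_by_index p_prime G_prop (nPhi i) (oPhi i) (oPhi i.+1) iE.
have := le_rg _ _ (nPhi i) (oPhi i) Nn.
rewrite -{1}(fineK fin) lee_fin sub_index_frattini ler_pdivlMr; last first.
  by rewrite ltr0n expn_gt0 prime_gt0.
by rewrite lerBrDr => /le_trans; apply; rewrite ler_nat.
Qed.

Lemma exists_subgroup_frattini_index (a : R) : (0 < rank_gradient R G)%E ->
  0 <= a <= 1 -> exists K : set G, [/\ is_subgroup K, closed K &
    exists n0, forall n, (n0 <= n)%N ->
      sub_index (setmulg K (Phi n)) (Phi n) =
      (p ^ Num.truncn (a * (flog n)%:R))%N].
Proof.
move=> rg0 /andP [a0 a1].
have [rho r0 rl] := rank_gradient_growth rg0.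
have lS i := (flog_step i).1.
(* The growth estimate covers only 0 < a < 1; the trivial subgroup and the whole group settle the
   two ends. *)
have [->|na0] := eqVneq a 0.
  exists [set 1%g]; split.
  - split=> [//|x y /= -> ->|x /= ->]; first by rewrite mulg1.
    by rewrite invg1.
  - by apply: compact_closed; [case: G_prop | exact: compact_set1].
  - exists 0%N => n _; rewrite mul0r truncn0 expn0.
    have -> : setmulg [set 1%g] (Phi n) = Phi n.
      apply/seteqP; split=> [_ [_ -> [y Py <-]]|y Py]; first by rewrite mul1g.
      by exists 1%g => //; exists y; rewrite ?mul1g.
    have [gT [f fq]] := finite_quotient cG (nPhi n) (oPhi n).
    rewrite (sub_index_quot (sPhi n) fq) (_ : fim f (Phi n) = 1%g) ?cards1 //.
    apply/setP => t; apply/fimP/set1gP => [[x /(quot_ker fq) -> <-] //|->].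
    by exists 1%g; [case: (sPhi n) | apply/(quot_ker fq); case: (sPhi n)].
have [->|na1] := eqVneq a 1.
  exists setT; split; [exact: is_subgroup_setT | exact: closedT |].
  exists 0%N => n _; rewrite mul1r natrK -sub_index_frattini.
  by rewrite setmulg_absorb //; apply: is_subgroup_setT.
have a01 : 0 < a < 1 by rewrite !lt_neqAle eq_sym na0 a0 na1 a1.
have [n0 Hn0] := truncn_growth p_prime a01 r0 lS rl.
pose tt n := Num.truncn (a * (flog n)%:R).
(* Dependent choice runs over pairs of a level and a subgroup, because the invariant depends on the
   level; the chain starts at [n0], so its n-th member lives at level [n0 + n]. *)
pose P (x : nat * set G) := [/\ (n0 <= x.1)%N, is_subgroup x.2, Phi x.1 `<=` x.2 &
  sub_index x.2 (Phi x.1) = (p ^ tt x.1)%N].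
have [|L0 [sL0 PL0 iL0]] := @frattini_intermediate n0 (tt n0).
  rewrite /tt truncn_le_nat -natr1; apply: ltr_pwDr => //.
  by rewrite ler_piMl.
have step (x : {x | P x}) :
    {y : {y | P y} | (sval y).1 = (sval x).1.+1 /\
      setmulg (sval y).2 (Phi (sval x).1) = (sval x).2}.
  apply: cid; case: x => -[n L] /= [/= nn sL PL iL].
  have [st ts] := Hn0 n nn.
  have [L' [sL' PL' LL' iL']] := frattini_supplement sL PL iL st ts.
  have PnL : P (n.+1, L') by split=> //=; apply: leqW.
  by exists (exist _ (n.+1, L') PnL).
have P0 : P (n0, L0) by [].
have [F [F0 FS]] := dependent_choice step (exist P (n0, L0) P0).
pose L n := (sval (F n)).2.
have F1 n : (sval (F n)).1 = (n0 + n)%N.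
  by elim: n => [|n IH]; rewrite ?F0 ?addn0 // (FS n).1 IH addnS.
have LP n : [/\ is_subgroup (L n), Phi (n0 + n) `<=` L n &
    sub_index (L n) (Phi (n0 + n)) = (p ^ tt (n0 + n))%N].
  by have [_ ? ? ?] := svalP (F n); rewrite -F1.
have cL n : closed (L n).
  have [sL PL _] := LP n; apply: open_subgroup_closed => //.
  exact: (subgroup_open_sub sL (sPhi (n0 + n)) (oPhi _) PL).
have LL : forall n, setmulg (\bigcap_i L i) (Phi (n0 + n)) = L n.
  apply: (bigcap_supplement cG (L := L) (N := fun n => Phi (n0 + n))) => //.
  - by move=> n; case: (LP n).
  - by move=> n; apply: open_subgroup_closed.
  - by move=> n; rewrite addnS; apply: PhiS.
  - by move=> n; rewrite -F1; apply: (FS n).2.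
exists (\bigcap_i L i); split.
- split=> [n _|x y Lx Ly n _|x Lx n _]; case: (LP n) => -[L1 LM LV] _ _ //.
    by apply: LM; [exact: Lx | exact: Ly].
  exact/LV/Lx.
- by apply: closed_bigI => n _.
- exists n0 => n nn; rewrite -(subnKC nn) LL.
  by case: (LP (n - n0)%N).
Qed.

End RankGradient.
End Tower.

(** * Direct products *)

Section Products.
Variables (r : nat) (H : 'I_r -> topGroupType).
Local Notation P := (dirprod H).
Implicit Types (A B : forall j, set (H j)).

Definition box A : set P := [set x | forall j, A j (x j)].

Lemma box_choice A (Q : forall j, H j -> Prop) :
  (forall j, exists2 a, A j a & Q j a) -> exists2 x : P, box A x & forall j, Q j (x j).
Proof.
move=> AQ; exists (fun j => sval (cid2 (AQ j))) => j;
  by case: (cid2 (AQ j)).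
Qed.

Lemma is_subgroup_box A : (forall j, is_subgroup (A j)) -> is_subgroup (box A).
Proof.
move=> sA; split=> [j|x y Ax Ay j|x Ax j]; case: (sA j) => A1 AM AV //.
  by apply: AM; [apply: Ax|apply: Ay].
by apply: AV; apply: Ax.
Qed.

Lemma closed_box A : (forall j, closed (A j)) -> closed (box A).
Proof.
move=> cA; have -> : box A = \bigcap_(j in [set: 'I_r]) [set x : P | A j (x j)].
  by apply/seteqP; split=> [x Ax j _|x Ax j]; [exact: Ax | exact: (Ax j I)].
apply: closed_bigI => j _; apply: preimage_closed => // x _.
exact: dirprod_proj_continuous.
Qed.

Lemma setmulg_box A B : setmulg (box A) (box B) = box (fun j => setmulg (A j) (B j)).
Proof.
apply/seteqP; split=> [_ [x Ax [y By <-]] j|z ABz].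
  by exists (x j) => //; exists (y j).
have [x Ax xz] := box_choice ABz; have [y By xyz] := box_choice xz.
exists x => //; exists y => //; apply: functional_extensionality_dep => j.
exact: xyz.
Qed.

Lemma commg_box A : [set [~ x, y] | x in box A & y in box A] =
  box (fun j => [set [~ x, y] | x in A j & y in A j]).
Proof.
apply/seteqP; split=> [_ [x Ax [y Ay <-]] j|z Az].
  by exists (x j) => //; exists (y j).
have [x Ax xz] := box_choice Az; have [y Ay xyz] := box_choice xz.
exists x => //; exists y => //; apply: functional_extensionality_dep => j.
exact: xyz.
Qed.

Lemma dirprod_expg (x : P) n j : (x ^+ n) j = x j ^+ n.
Proof.
elim: n => [|n IH]; first by rewrite !expg0.
by rewrite (expgS (x j)) -IH expgS.
Qed.

Lemma expg_box A n : [set x ^+ n | x in box A] = box (fun j => [set x ^+ n | x in A j]).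
Proof.
apply/seteqP; split=> [_ [x Ax <-] j|z Az]; first by rewrite dirprod_expg; exists (x j).
have [x Ax xz] := box_choice Az; exists x => //.
by apply: functional_extensionality_dep => j; rewrite dirprod_expg xz.
Qed.

Let coord_inj (j : 'I_r) (y : H j) : P := eqtype.dfwith (fun i => 1 : H i) y.

Let coord_inj_mul j : {morph @coord_inj j : x y / x * y}.
Proof.
move=> x y; apply: functional_extensionality_dep => i.
have E : (coord_inj x * coord_inj y) i = coord_inj x i * coord_inj y i by [].
rewrite E /coord_inj; have [<-|ji] := eqVneq j i; first by rewrite !dfwith_in.
by rewrite !dfwith_out // mulg1.
Qed.

Let coord_inj_continuous j : continuous (@coord_inj j).
Proof.
apply: dirprod_continuous => i; have [ji|ji] := eqVneq j i.
  case: _ / ji; rewrite (_ : (fun x => coord_inj x j) = id); first by move=> x; exact: cvg_id.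
  by apply: funext => x; rewrite /coord_inj dfwith_in.
rewrite (_ : (fun x => coord_inj x i) = cst 1); first exact: cst_continuous.
by apply: funext => x; rewrite /coord_inj dfwith_out.
Qed.

(* Each point of the product is a product of points supported on one coordinate. *)
Lemma tgen_box A : (forall j, A j 1) -> tgen (box A) = box (fun j => tgen (A j)).
Proof.
move=> A1; apply/seteqP; split.
  apply: tgen_sub.
  - by apply: is_subgroup_box => j; apply: is_subgroup_tgen.
  - by apply: closed_box => j; apply: closed_closure.
  - by move=> x Ax j; apply/sub_tgen/Ax.
have [t1 tM tV] := is_subgroup_tgen (box A).
have injA j : tgen (A j) `<=` [set y | tgen (box A) (coord_inj y)].
  have inj1 : @coord_inj j 1 = 1.
    apply: functional_extensionality_dep => i; rewrite /coord_inj.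
    by have [<-|ji] := eqVneq j i; rewrite ?dfwith_in // dfwith_out.
  apply: tgen_sub.
  - split=> /=; first by rewrite inj1.
      by move=> x y Ax Ay; rewrite coord_inj_mul; apply: tM.
    move=> x Ax; rewrite (_ : coord_inj x^-1 = (coord_inj x)^-1); first exact: tV.
    apply: functional_extensionality_dep => i.
    have -> : (coord_inj x)^-1 i = (coord_inj x i)^-1 by [].
    rewrite /coord_inj; have [<-|ji] := eqVneq j i; first by rewrite !dfwith_in.
    by rewrite !dfwith_out // invg1.
  - apply: preimage_closed; last exact: closed_closure.
    by move=> x _; apply: coord_inj_continuous.
  - move=> y Ay; apply: sub_tgen => i; rewrite /coord_inj.
    by have [<-|ji] := eqVneq j i; rewrite ?dfwith_in // dfwith_out.
move=> x Ax; pose z n : P := fun j => if (j < n)%N then x j else 1.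
have zr : z r = x by apply: functional_extensionality_dep => j; rewrite /z ltn_ord.
have zt n : (n <= r)%N -> tgen (box A) (z n); last by rewrite -zr; apply: zt.
elim: n => [|n IH] nr.
  by rewrite (_ : z 0%N = 1) //; exact: functional_extensionality_dep.
rewrite (_ : z n.+1 = z n * coord_inj (x (Ordinal nr))).
  by apply: tM; [apply: IH; apply: ltnW | apply: injA; apply: Ax].
apply: functional_extensionality_dep => j.
have -> : (z n * coord_inj (x (Ordinal nr))) j =
  z n j * coord_inj (x (Ordinal nr)) j by [].
rewrite /z /coord_inj; have [<-|nj] := eqVneq (Ordinal nr) j.
  by rewrite dfwith_in /= ltnn ltnSn mul1g.
rewrite dfwith_out // mulg1 ltnS leq_eqVlt.
by rewrite -(inj_eq val_inj) /= eq_sym in nj; rewrite (negPf nj).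
Qed.

Lemma frattini_series_box p i : (forall j k, is_subgroup (frattini_series p (H j) k)) ->
  frattini_series p P i = box (fun j => frattini_series p (H j) i).
Proof.
move=> sF; elim: i => [|i IH]; first by apply/seteqP; split.
(* Both generating sets contain 1 in every coordinate, as [tgen_box] requires. *)
rewrite /= IH commg_box expg_box !tgen_box; last 2 first.
- by move=> j; have [F1 _ _] := sF j i; exists 1; rewrite ?expg1n.
- by move=> j; have [F1 _ _] := sF j i; exists 1 => //; exists 1; rewrite ?commg1.
exact: setmulg_box.
Qed.

(** The quotient maps of the factors combine into a map to dependent finite functions. Its fibres
    are the cosets of [box N], and the image of [box A] is a full family of choices. *)
Lemma sub_index_box A N : (forall j, compact [set: H j]) ->
  (forall j, is_normal (N j)) -> (forall j, open (N j)) ->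
  sub_index (box A) (box N) = (\prod_j sub_index (A j) (N j))%N.
Proof.
move=> cH nN oN.
pose gT j : finGroupType := sval (cid (finite_quotient (cH j) (nN j) (oN j))).
pose f j : H j -> gT j := sval (cid (svalP (cid (finite_quotient (cH j) (nN j) (oN j))))).
have fq j : is_quotient (N j) (@f j).
  exact: (svalP (cid (svalP (cid (finite_quotient (cH j) (nN j) (oN j)))))).
pose F (x : P) : {dffun forall j, gT j} := [ffun j => f j (x j)].
rewrite (@sub_indexE P _ F).
- transitivity #|(family (fun j => mem (fim (@f j) (A j))) :
    simpl_pred {dffun forall j, gT j})|.
    apply: eq_card => t; apply/fimP/familyP => [[x Ax <-] j|tA].
      by rewrite ffunE; apply: mem_fim.
    have /box_choice [x Ax xt] : forall j, exists2 a, A j a & f j a = t j.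
      by move=> j; apply/fimP; apply: tA.
    by exists x => //; apply/ffunP => j; rewrite ffunE xt.
  rewrite card_family foldrE big_map big_enum /=.
  by apply: eq_bigr => j _; rewrite (sub_index_quot (nN j).1 (fq j)).
- by apply: is_subgroup_box => j; case: (nN j).
- move=> x y; split=> [/ffunP xy j|xy].
    by have := xy j; rewrite !ffunE => /(quot_eq (nN j).1 (fq j)).
  by apply/ffunP => j; rewrite !ffunE; apply/(quot_eq (nN j).1 (fq j)); apply: xy.
Qed.

End Products.

(** * Hausdorff dimension *)

Section HausdorffDimension.
Variable R : realType.
Local Open Scope ring_scope.

Lemma limn_einf_itv (u : nat -> \bar R) (x y : \bar R) :
  (forall n, x <= u n <= y)%E -> (x <= limn_einf u <= y)%E.
Proof.
move=> uxy; rewrite limn_einf_lim; apply/andP; split.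
  apply: lime_ge; first exact: is_cvg_einfs.
  apply: nearW => n; apply: le_ereal_inf_tmp => _ [k _ <-].
  by case/andP: (uxy k).
apply: lime_le; first exact: is_cvg_einfs.
apply: nearW => n; apply: (@le_trans _ _ (u n)); last by case/andP: (uxy n).
by apply: ereal_inf_lbound; exists n => /=.
Qed.

(** An infinite set of cosets is counted as 0, so the positive total index encodes finiteness. *)
Lemma sub_index_le (G : topGroupType) (A N : set G) :
  (0 < sub_index [set: G] N)%N -> (sub_index A N <= sub_index [set: G] N)%N.
Proof.
rewrite /sub_index; set C := [set _ | _ in [set: G]] => C0.
have fC : finite_set C.
  by apply: contrapT => nC; move: C0; rewrite /fset_set; case: pselect.
have AC : [set setmulg [set x] N | x in A] `<=` C by move=> _ [x _ <-]; exists x.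
apply: fsubset_leq_card; rewrite -fset_set_sub //.
exact: sub_finite_set AC fC.
Qed.

Lemma ln_nat_ge0 n : 0 <= ln (n%:R : R).
Proof. by case: n => [|n]; [rewrite ln0 | rewrite ln_ge0 // ler1n]. Qed.

Lemma hdim_itv (p : nat) (G : topGroupType) (S : nat -> set G) (K : set G) :
  (forall i, 0 < sub_index [set: G] (S i))%N -> (0 <= hdim R p S K <= 1)%E.
Proof.
move=> S0; apply: limn_einf_itv => i; rewrite !lee_fin /log_p.
set a := sub_index _ _; set b := sub_index _ _.
have ab : (a <= b)%N by apply: sub_index_le.
have la : 0 <= ln (a%:R : R) / ln p%:R by rewrite divr_ge0 ?ln_nat_ge0.
have lab : ln (a%:R : R) / ln p%:R <= ln b%:R / ln p%:R.
  apply: ler_wpM2r; first by rewrite invr_ge0 ln_nat_ge0.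
  case: (posnP a) => [->|a0]; first by rewrite ln0 // ln_nat_ge0.
  by rewrite ler_ln ?posrE ?ltr0n ?ler_nat // S0.
have lb := le_trans la lab.
(* A vanishing denominator gives the quotient 0 by convention. *)
rewrite divr_ge0 //=; have [->|b0] := eqVneq (ln (b%:R : R) / ln p%:R) 0.
  by rewrite invr0 mulr0.
by rewrite ler_pdivrMr ?mul1r // lt_neqAle eq_sym b0.
Qed.

Lemma log_p_expn (p n : nat) : (1 < p)%N -> log_p p ((p ^ n)%N%:R : R) = n%:R.
Proof.
move=> p1; rewrite /log_p natrX lnXn ?ltr0n ?(ltnW p1) //.
by rewrite -(mulr_natl (ln _)) mulfK // gt_eqF // ln_gt0 // ltr1n.
Qed.

(** Each truncation loses at most 1, so the ratio differs from [a] by at most r divided by the sum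
    of the [l j i], and that sum is at least i. No comparison between the different [l j] enters. *)
Lemma cvg_truncn_average (r : nat) (a : R) (l : 'I_r -> nat -> nat) :
  (0 < r)%N -> 0 <= a -> (forall j i, (i <= l j i)%N) ->
  (fun i => (\sum_j Num.truncn (a * (l j i)%:R))%N%:R / (\sum_j l j i)%N%:R : R)
    @ \oo --> a.
Proof.
move=> r0 a0 li; apply/cvgrPdist_le => e e0.
exists (Num.truncn (r%:R / e)).+1 => // i /= ni.
set L := (\sum_j l j i)%N; set S := (\sum_j _)%N.
have iL : (i <= L)%N.
  by rewrite /L (bigD1 (Ordinal r0)) //=; apply: leq_trans (li _ i) (leq_addr _ _).
have re : r%:R / e < i%:R.
  have /andP [_ h] := truncn_itv (divr_ge0 (ler0n R r) (ltW e0)).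
  by apply: (lt_le_trans h); rewrite ler_nat.
have L0 : 0 < L%:R :> R by rewrite ltr0n (leq_trans _ iL) // (leq_trans _ ni).
have Lr : r%:R <= e * L%:R.
  rewrite -ler_pdivrMl // mulrC; apply: (le_trans (ltW re)).
  by rewrite ler_nat.
have SE : S%:R = \sum_j (Num.truncn (a * (l j i)%:R))%:R :> R by rewrite natr_sum.
have LE : a * L%:R = \sum_j a * (l j i)%:R by rewrite natr_sum mulr_sumr.
have SL : S%:R <= a * L%:R.
  rewrite SE LE; apply: ler_sum => j _.
  by have /andP [] := truncn_itv (mulr_ge0 a0 (ler0n R (l j i))).
have LS : a * L%:R <= S%:R + r%:R.
  have -> : r%:R = \sum_(j < r) 1 :> R by rewrite sumr_const card_ord.
  rewrite SE LE -big_split /=; apply: ler_sum => j _.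
  by have /andP [_ /ltW] := truncn_itv (mulr_ge0 a0 (ler0n R (l j i))); rewrite -natr1.
have -> : a - S%:R / L%:R = (a * L%:R - S%:R) / L%:R.
  by rewrite mulrBl mulfK // gt_eqF.
rewrite ger0_norm; last by rewrite divr_ge0 ?subr_ge0 // ltW.
rewrite ler_pdivrMr //; lra.
Qed.

End HausdorffDimension.

(** * The Hausdorff spectrum of the direct product *)

Theorem theorem1p2 (R : realType) (p : nat) (p_prime : prime p)
    (r : nat) (r_gt0 : (0 < r)%N) (H : 'I_r -> topGroupType)
    (H_prop : forall j, pro_p p (H j))
    (H_fg : forall j, finitely_generated (H j))
    (H_rg : forall j, (0 < rank_gradient R (H j))%E) :
  hspec R p (dirprod H) (frattini_series p (dirprod H)) =
  [set x : \bar R | (0 <= x <= 1)%E].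
Proof.
have cH j : compact [set: H j] by case: (H_prop j).
have nP j i := (frattini_series_open_normal p_prime (H_prop j) (H_fg j) i).1.
have oP j i := (frattini_series_open_normal p_prime (H_prop j) (H_fg j) i).2.
have PE i : frattini_series p (dirprod H) i =
    box (fun j => frattini_series p (H j) i).
  by apply: frattini_series_box => j k; case: (nP j k).
have iP i : sub_index [set: dirprod H] (frattini_series p (dirprod H) i) =
    (p ^ \sum_j flog p (H j) i)%N.
  rewrite PE (_ : [set: dirprod H] = box (fun j => [set: H j])); last first.
    by apply/seteqP; split.
  rewrite sub_index_box // expn_sum; apply: eq_bigr => j _.
  exact: (sub_index_frattini p_prime (H_prop j) (H_fg j)).
apply/seteqP; split=> [_ [K _ <-]|x /= x01].
  by apply: hdim_itv => i; rewrite iP expn_gt0 prime_gt0.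
have [a ax a01] : exists2 a : R, x = a%:E & (0 <= a <= 1)%R.
  case: x x01 => [a|/andP[]|/andP[]] //; rewrite !lee_fin => a01.
  by exists a.
pose KP j (K : set (H j)) := [/\ is_subgroup K, closed K &
  exists n0, forall n, (n0 <= n)%N ->
    sub_index (setmulg K (frattini_series p (H j) n)) (frattini_series p (H j) n) =
    (p ^ Num.truncn (a * (flog p (H j) n)%:R)%R)%N].
have exK j : exists K, KP j K.
  exact: (exists_subgroup_frattini_index p_prime (H_prop j) (H_fg j) (H_rg j) a01).
pose K j := sval (cid (exK j)); have KK j : KP j (K j) := svalP (cid (exK j)).
have n0P j : exists n0, forall n, (n0 <= n)%N ->
    sub_index (setmulg (K j) (frattini_series p (H j) n)) (frattini_series p (H j) n) =
    (p ^ Num.truncn (a * (flog p (H j) n)%:R)%R)%N by case: (KK j).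
pose n0 j := sval (cid (n0P j)).
exists (box K).
  by split; [apply: is_subgroup_box | apply: closed_box] => j; case: (KK j).
(* The sequence of ratios actually converges to [a], which identifies its lower limit. *)
rewrite /hdim ax; apply: (cvg_limn_einf_sup _).1.
apply: cvg_EFin; first exact: nearW.
have a0 : (0 <= a)%R by case/andP: a01.
have li j i : (i <= flog p (H j) i)%N.
  have [rho r0 rl] := rank_gradient_growth p_prime (H_prop j) (H_fg j) (H_rg j).
  exact: leq_id_growth r0 rl i.
apply: cvg_trans (cvg_truncn_average r_gt0 a0 li); apply: near_eq_cvg.
(* Beyond the largest threshold of the factors all indices are the prescribed powers of p, and the
   ratio equals the one in [cvg_truncn_average]. *)
exists (\max_j n0 j)%N => // i /= ni.
rewrite iP PE setmulg_box sub_index_box //.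
rewrite [in RHS](eq_bigr (fun j => p ^ Num.truncn (a * (flog p (H j) i)%:R)%R)%N).
  by rewrite -expn_sum !log_p_expn ?prime_gt1.
move=> j _; apply: (svalP (cid (n0P j))); apply: leq_trans ni.
exact: (leq_bigmax (F := n0) j).
Qed.
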